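(* Let $H$ be a Hopf algebra with invertible antipode over a field $k$ of characteristic $0$, and suppose there is a right integral $\chi\in H^*$ with $\chi(1)\neq0$, so that as a coalgebra $H=\bigoplus_iC_i$ with $C_i$ finite dimensional simple subcoalgebras. Then the category of right $H$-comodules and the category of right $H$-contramodules are equivalent. The former consists of $\bigoplus_iM_i$ and the latter of $\prod_iM_i$, where the $M_i$ are right $C_i$-comodules, i.e. $M_i\in\mathcal{M}^{C_i}$.
   Context: Sweedler notation: $\Delta(h)=h^1\otimes h^2$; a right coaction is $m\mapsto m_0\otimes m_1$. A right integral is $\chi\in H^*$ with $\chi(h^1)h^2=\chi(h)1$ for all $h\in H$. $\mathrm{Hom}$ denotes $k$-linear maps. A right contramodule over a counital coalgebra $C$ is a vector space $N$ with linear $\alpha:\mathrm{Hom}(C,N)\to N$ such that $\alpha(x\mapsto\alpha(h\mapsto f(x\otimes h)))=\alpha(h\mapsto f(h^1\otimes h^2))$ for $f\in\mathrm{Hom}(C\otimes C,N)$ and $\alpha(h\mapsto\epsilon(h)n)=n$ for $n\in N$; morphisms are linear maps commuting with $\alpha$. Given $M_i\in\mathcal{M}^{C_i}$ for all $i$, the vector space $\prod_iM_i$ is regarded as an $H$-contramodule via $\alpha(f)=(\alpha^i(f_i|_{C_i}))_i$, where $f_i:H\to M_i$ is the $i$-th component of $f\in\mathrm{Hom}(H,\prod_iM_i)$ and $\alpha^i:\mathrm{Hom}(C_i,M_i)=M_i\otimes C_i^*\to M_i$, $m\otimes\chi\mapsto\chi(m_1)m_0$. The vector space $\bigoplus_iM_i$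 is an $H$-comodule in the evident way. The equivalence is the correspondence $\bigoplus_iM_i\leftrightarrow\prod_iM_i$. *)

(* Defs.v *)
From HB Require Import structures.
From mathcomp Require Import all_boot all_algebra.
From mathcomp Require Import boolp classical_sets functions cardinality fsbigop.

Set Implicit Arguments.
Unset Strict Implicit.
Unset Printing Implicit Defensive.

Import GRing.Theory.
Local Open Scope ring_scope.
Local Open Scope quotient_scope.

Declare Scope tensor_scope.
Delimit Scope tensor_scope with tensor.
Open Scope tensor_scope.
Reserved Notation "V \Ox W" (at level 40, left associativity).
Reserved Notation "v \ox w" (at level 40, left associativity).
Reserved Notation "\sw_ ( a , b <- t ) E"
  (at level 41, E at level 41, a name, b name,
   format "'[' \sw_ ( a ,  b  <-  t ) '/  '  E ']'").

Section LinearMaps.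
Variables (k : fieldType) (V W : lmodType k).
Implicit Types f g h : {linear V -> W}.

Lemma lin_ext f g : f =1 g -> f = g.
Proof.
case: f g => [f [[f1] [f2]]] [g [[g1] [g2]]] /= /funext fg; subst g.
by rewrite (Prop_irrelevance f2 g2); congr GRing.Linear.Pack;
  congr GRing.Linear.Class; congr GRing.isNmodMorphism.Axioms_.
Qed.

Definition mk_lin (f : V -> W) (lf : linear f) : {linear V -> W} :=
  HB.pack f (GRing.isLinear.Build k V W *:%R f lf).

Lemma mk_linE (f : V -> W) (lf : linear f) x : mk_lin lf x = f x.
Proof. by []. Qed.

HB.instance Definition _ := gen_eqMixin {linear V -> W}.
HB.instance Definition _ := gen_choiceMixin {linear V -> W}.

Definition lin0 : {linear V -> W} := \0.
Definition linD f g : {linear V -> W} := f \+ g.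
Definition linN f : {linear V -> W} := \- f.
Definition linZ (a : k) f : {linear V -> W} := a \*: f.

Fact linDA : associative linD.
Proof. by move=> f g h; apply: lin_ext => x /=; rewrite addrA. Qed.
Fact linDC : commutative linD.
Proof. by move=> f g; apply: lin_ext => x /=; rewrite addrC. Qed.
Fact lin0D : left_id lin0 linD.
Proof. by move=> f; apply: lin_ext => x /=; rewrite add0r. Qed.
Fact linND : left_inverse lin0 linN linD.
Proof. by move=> f; apply: lin_ext => x /=; rewrite addNr. Qed.
HB.instance Definition _ :=
  GRing.isZmodule.Build {linear V -> W} linDA linDC lin0D linND.

Fact linZA a b f : linZ a (linZ b f) = linZ (a * b) f.
Proof. by apply: lin_ext => x /=; rewrite scalerA. Qed.
Fact lin1Z : left_id 1 linZ.
Proof. by move=> f; apply: lin_ext => x /=; rewrite scale1r. Qed.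
Fact linZDr : right_distributive linZ +%R.
Proof. by move=> a f g; apply: lin_ext => x /=; rewrite scalerDr. Qed.
Fact linZDl f : {morph linZ^~ f : a b / a + b}.
Proof. by move=> a b; apply: lin_ext => x /=; rewrite scalerDl. Qed.
HB.instance Definition _ :=
  GRing.Zmodule_isLmodule.Build k {linear V -> W} linZA lin1Z linZDr linZDl.

Lemma linDE f g x : (f + g) x = f x + g x. Proof. by []. Qed.
Lemma linZE (a : k) f x : (a *: f) x = a *: f x. Proof. by []. Qed.
Lemma lin0E x : (0 : {linear V -> W}) x = 0. Proof. by []. Qed.

End LinearMaps.

Section Tensor.
Variables (k : fieldType) (V W : lmodType k).

(* A sequence [:: (v1, w1); ...; (vn, wn)] stands for the formal sum of the
   v_i \ox w_i; [teq] is the congruence imposing bilinearity. *)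
Inductive teq : seq (V * W) -> seq (V * W) -> Prop :=
| teq_refl s : teq s s
| teq_sym s t : teq s t -> teq t s
| teq_trans s t u : teq s t -> teq t u -> teq s u
| teq_cat s s' t t' : teq s s' -> teq t t' -> teq (s ++ t) (s' ++ t')
| teq_catC s t : teq (s ++ t) (t ++ s)
| teq_zero w : teq [:: (0, w)] [::]
| teq_addl v v' w : teq [:: (v + v', w)] [:: (v, w); (v', w)]
| teq_addr v w w' : teq [:: (v, w + w')] [:: (v, w); (v, w')]
| teq_scale a v w : teq [:: (a *: v, w)] [:: (v, a *: w)].

Definition teqb s t : bool := `[< teq s t >].
Fact teqb_refl : reflexive teqb.
Proof. by move=> s; apply/asboolP/teq_refl. Qed.
Fact teqb_sym : symmetric teqb.
Proof. by move=> s t; apply/asboolP/asboolP; apply: teq_sym. Qed.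
Fact teqb_trans : transitive teqb.
Proof. by move=> s t u /asboolP ts /asboolP su; apply/asboolP/(teq_trans ts). Qed.
Canonical teqb_equiv := EquivRel teqb teqb_refl teqb_sym teqb_trans.

Definition tens := {eq_quot teqb}.
HB.instance Definition _ := Choice.on tens.
HB.instance Definition _ := Quotient.on tens.
HB.instance Definition _ := EqQuotient.on tens.

Definition tmk (s : seq (V * W)) : tens := \pi_tens s.

Lemma tmkP s t : tmk s = tmk t <-> teq s t.
Proof.
split=> [|st]; first by move=> /eqmodP /asboolP.
by apply/eqmodP/asboolP.
Qed.

Lemma tmkK (x : tens) : tmk (repr x) = x.
Proof. exact: reprK. Qed.

Definition taddt (x y : tens) : tens := tmk (repr x ++ repr y).
Definition tzero : tens := tmk [::].
Definition tscale (a : k) (x : tens) : tens :=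
  tmk [seq (a *: p.1, p.2) | p <- repr x].

Lemma tmk_cat s t : tmk (s ++ t) = taddt (tmk s) (tmk t).
Proof. by apply/tmkP/teq_cat; apply/tmkP; rewrite tmkK. Qed.

Lemma teq_mapZ a s t : teq s t ->
  teq [seq (a *: p.1, p.2) | p <- s] [seq (a *: p.1, p.2) | p <- t].
Proof.
elim=> {s t}; rewrite /= ?map_cat.
- by move=> s; apply: teq_refl.
- by move=> s t _; apply: teq_sym.
- by move=> s t u _ + _; apply: teq_trans.
- by move=> s s' t t' _ ? _ ?; rewrite !map_cat; apply: teq_cat.
- by move=> s t; rewrite !map_cat; apply: teq_catC.
- by move=> w; rewrite scaler0; apply: teq_zero.
- by move=> v v' w; rewrite scalerDr; apply: teq_addl.
- by move=> v w w'; apply: teq_addr.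
- by move=> b v w; rewrite scalerA mulrC -scalerA; apply: teq_scale.
Qed.

Lemma tmk_scale a s : tmk [seq (a *: p.1, p.2) | p <- s] = tscale a (tmk s).
Proof. by apply/tmkP/teq_mapZ/tmkP; rewrite tmkK. Qed.

Fact taddtA : associative taddt.
Proof.
by move=> x y z; rewrite -(tmkK x) -(tmkK y) -(tmkK z) -!tmk_cat catA.
Qed.
Fact taddtC : commutative taddt.
Proof.
by move=> x y; rewrite -(tmkK x) -(tmkK y) -!tmk_cat; apply/tmkP/teq_catC.
Qed.
Fact tadd0t : left_id tzero taddt.
Proof. by move=> x; rewrite -(tmkK x) -tmk_cat. Qed.
Fact tscaleA a b x : tscale a (tscale b x) = tscale (a * b) x.
Proof.
rewrite -(tmkK x) -!tmk_scale -map_comp; congr tmk.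
by apply: eq_map => p /=; rewrite scalerA.
Qed.
Fact tscale1 : left_id 1 tscale.
Proof.
move=> x; rewrite -{2}(tmkK x) -{1}(tmkK x) -tmk_scale; congr tmk.
by rewrite -[RHS]map_id; apply: eq_map => -[v w] /=; rewrite scale1r.
Qed.
Fact tscaleDr : right_distributive tscale taddt.
Proof.
move=> a x y; rewrite -(tmkK x) -(tmkK y).
by rewrite -(tmk_cat (repr x)) -!tmk_scale map_cat tmk_cat.
Qed.
Fact tscaleDl x : {morph tscale^~ x : a b / a + b >-> taddt a b}.
Proof.
move=> a b; rewrite -(tmkK x); elim: (repr x) => [|[v w] s IH].
  by rewrite -!tmk_scale -tmk_cat.
rewrite -cat1s tmk_cat !tscaleDr IH -!tmk_scale /=.
have -> : tmk [:: ((a + b) *: v, w)] =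
          taddt (tmk [:: (a *: v, w)]) (tmk [:: (b *: v, w)]).
  by rewrite -tmk_cat; apply/tmkP; rewrite scalerDl; apply: teq_addl.
by rewrite -!taddtA; congr taddt; rewrite !taddtA (taddtC (tmk [:: (b *: v, w)])).
Qed.
Fact taddNt : left_inverse tzero (tscale (-1)) taddt.
Proof.
move=> x; rewrite -{2}(tscale1 x) -tscaleDl addNr -(tmkK x) -tmk_scale.
elim: (repr x) => [//|[v w] s IH] /=.
rewrite -cat1s tmk_cat IH scale0r -tmk_cat cats0.
by apply/tmkP/teq_zero.
Qed.
HB.instance Definition _ :=
  GRing.isZmodule.Build tens taddtA taddtC tadd0t taddNt.
HB.instance Definition _ :=
  GRing.Zmodule_isLmodule.Build k tens tscaleA tscale1 tscaleDr tscaleDl.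

Definition pure (v : V) (w : W) : tens := tmk [:: (v, w)].

(* Sweedler summation: the sum of the [f a b] over a chosen way of writing
   [t] as a sum of pure tensors [a \ox b].  It is independent of this choice
   when [f] is bilinear, see [sweedler_pure] and [sweedler_linear]. *)
Definition sweedler (U : lmodType k) (t : tens) (f : V -> W -> U) : U :=
  \sum_(p <- repr t) f p.1 p.2.

Definition bilin (U : lmodType k) (f : V -> W -> U) :=
  (forall w, linear (f^~ w)) /\ (forall v, linear (f v)).

End Tensor.

Notation "V \Ox W" := (tens V W) : tensor_scope.
Notation "v \ox w" := (pure v w) : tensor_scope.
Notation "\sw_ ( a , b <- t ) E" := (sweedler t (fun a b => E)) : tensor_scope.

Section TensorTheory.
Variables (k : fieldType) (V W : lmodType k).
Implicit Types (t : V \Ox W) (U : lmodType k).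

Lemma tmkE (s : seq (V * W)) : tmk s = \sum_(p <- s) p.1 \ox p.2 :> V \Ox W.
Proof.
elim: s => [|[v w] s IH]; first by rewrite big_nil.
by rewrite big_cons -IH -cat1s tmk_cat.
Qed.

Lemma pureDl (v v' : V) (w : W) : (v + v') \ox w = v \ox w + v' \ox w.
Proof. by rewrite [RHS](esym (tmk_cat _ _)); apply/tmkP/teq_addl. Qed.
Lemma pureDr (v : V) (w w' : W) : v \ox (w + w') = v \ox w + v \ox w'.
Proof. by rewrite [RHS](esym (tmk_cat _ _)); apply/tmkP/teq_addr. Qed.
Lemma pureZl a (v : V) (w : W) : (a *: v) \ox w = a *: (v \ox w).
Proof. exact: tmk_scale a [:: (v, w)]. Qed.
Lemma pureZr a (v : V) (w : W) : v \ox (a *: w) = a *: (v \ox w).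
Proof. by rewrite -pureZl; apply/esym/tmkP/teq_scale. Qed.

Lemma pure_bilin : bilin (@pure k V W).
Proof.
by split=> [w|v] a x y; rewrite ?pureDl ?pureZl // pureDr pureZr.
Qed.

Definition purel (v : V) : {linear W -> V \Ox W} := mk_lin (pure_bilin.2 v).
Definition purer (w : W) : {linear V -> V \Ox W} := mk_lin (pure_bilin.1 w).

Lemma tens_ind (P : V \Ox W -> Prop) :
  P 0 -> (forall v w t, P t -> P (v \ox w + t)) -> forall t, P t.
Proof.
move=> P0 PD t; rewrite -(tmkK t) tmkE; elim: (repr t) => [|p s IH].
  by rewrite big_nil.
by rewrite big_cons; apply: PD.
Qed.

Lemma lin_tens_ext U (f g : {linear V \Ox W -> U}) :
  (forall v w, f (v \ox w) = g (v \ox w)) -> f =1 g.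
Proof.
move=> fg; elim/tens_ind=> [|v w t IH]; first by rewrite !linear0.
by rewrite !linearD fg IH.
Qed.

Section Bilinear.
Variables (U : lmodType k) (f : V -> W -> U).
Hypothesis bf : bilin f.

Lemma bilinDl v v' w : f (v + v') w = f v w + f v' w.
Proof. exact: (linearD (mk_lin (bf.1 w))). Qed.
Lemma bilinZl a v w : f (a *: v) w = a *: f v w.
Proof. exact: (linearZZ (mk_lin (bf.1 w))). Qed.
Lemma bilinDr v w w' : f v (w + w') = f v w + f v w'.
Proof. exact: (linearD (mk_lin (bf.2 v))). Qed.
Lemma bilinZr a v w : f v (a *: w) = a *: f v w.
Proof. exact: (linearZZ (mk_lin (bf.2 v))). Qed.
Lemma bilin0l w : f 0 w = 0.
Proof. exact: (linear0 (mk_lin (bf.1 w))). Qed.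

Lemma teq_sum (s t : seq (V * W)) : teq s t ->
  \sum_(p <- s) f p.1 p.2 = \sum_(p <- t) f p.1 p.2.
Proof.
elim=> {s t} //.
- by move=> s t u _ -> _ ->.
- by move=> s s' t t' _ IHs _ IHt; rewrite !big_cat /= IHs IHt.
- by move=> s t; rewrite !big_cat /= addrC.
- by move=> w; rewrite big_seq1 big_nil bilin0l.
- by move=> v v' w; rewrite !big_cons !big_nil /= !addr0 bilinDl.
- by move=> v w w'; rewrite !big_cons !big_nil /= !addr0 bilinDr.
- by move=> a v w; rewrite !big_seq1 /= bilinZl bilinZr.
Qed.

Lemma sweedler_tmk (s : seq (V * W)) : sweedler (tmk s) f = \sum_(p <- s) f p.1 p.2.
Proof. by apply/teq_sum/tmkP; rewrite tmkK. Qed.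

Lemma sweedler_pure v w : sweedler (v \ox w) f = f v w.
Proof. by rewrite sweedler_tmk big_seq1. Qed.

Lemma sweedler_linear : linear (fun t => sweedler t f).
Proof.
move=> a t u; rewrite -(tmkK t) -(tmkK u).
have -> : a *: tmk (repr t) + tmk (repr u) =
   tmk ([seq (a *: p.1, p.2) | p <- repr t] ++ repr u) :> V \Ox W.
  by rewrite tmk_cat tmk_scale.
rewrite !sweedler_tmk big_cat big_map /= scaler_sumr; congr (_ + _).
by apply: eq_bigr => p _; rewrite bilinZl.
Qed.

Definition tens_lift : {linear V \Ox W -> U} := mk_lin sweedler_linear.

Lemma tens_lift_pure v w : tens_lift (v \ox w) = f v w.
Proof. exact: sweedler_pure. Qed.

Lemma tens_lift_unique (g : {linear V \Ox W -> U}) :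
  (forall v w, g (v \ox w) = f v w) -> g = tens_lift.
Proof.
move=> gf; apply/lin_ext/lin_tens_ext => v w.
by rewrite gf tens_lift_pure.
Qed.

Lemma sweedler0 : sweedler 0 f = 0.
Proof. exact: (linear0 tens_lift). Qed.
Lemma sweedlerD t u : sweedler (t + u) f = sweedler t f + sweedler u f.
Proof. exact: (linearD tens_lift). Qed.
Lemma sweedlerZ a t : sweedler (a *: t) f = a *: sweedler t f.
Proof. exact: (linearZZ tens_lift). Qed.

Lemma sweedler_sum (J : Type) (r : seq J) (F : J -> V \Ox W) :
  sweedler (\sum_(j <- r) F j) f = \sum_(j <- r) sweedler (F j) f.
Proof. exact: (linear_sum tens_lift). Qed.

Lemma sweedler_sweedler (V' W' : lmodType k) (t : V' \Ox W')
    (g : V' -> W' -> V \Ox W) :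
  sweedler (sweedler t g) f = sweedler t (fun a b => sweedler (g a b) f).
Proof. by rewrite [sweedler t g]/sweedler sweedler_sum. Qed.

End Bilinear.

Lemma eq_sweedler U t (f g : V -> W -> U) :
  (forall v w, f v w = g v w) -> sweedler t f = sweedler t g.
Proof. by move=> fg; apply: eq_bigr. Qed.

Lemma linear_sweedler U U' (g : {linear U -> U'}) t (f : V -> W -> U) :
  g (sweedler t f) = sweedler t (fun v w => g (f v w)).
Proof. exact: linear_sum. Qed.

Lemma sweedler_id t : \sw_(v, w <- t) (v \ox w) = t.
Proof. by rewrite -{2}(tmkK t) tmkE. Qed.

Lemma sweedler_lin U U' t (f : V -> W -> U -> U') :
  (forall v w, linear (f v w)) -> linear (fun x => \sw_(v, w <- t) f v w x).
Proof.
move=> lf a x y; rewrite /sweedler scaler_sumr -big_split /=.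
by apply: eq_bigr => p _; rewrite lf.
Qed.

End TensorTheory.

Section TensorMap.
Variables (k : fieldType).

Lemma tens_map_bilin (V W V' W' : lmodType k)
    (f : {linear V -> V'}) (g : {linear W -> W'}) :
  bilin (fun v w => f v \ox g w).
Proof.
by split=> [w|v] a x y; rewrite linearP ?pureDl ?pureZl // pureDr pureZr.
Qed.

Definition tens_map (V W V' W' : lmodType k)
    (f : {linear V -> V'}) (g : {linear W -> W'}) :
  {linear V \Ox W -> V' \Ox W'} := tens_lift (tens_map_bilin f g).

Lemma tens_map_pure (V W V' W' : lmodType k)
    (f : {linear V -> V'}) (g : {linear W -> W'}) v w :
  tens_map f g (v \ox w) = f v \ox g w.
Proof. exact: tens_lift_pure. Qed.

Lemma tens_mapE (V W V' W' : lmodType k)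
    (f : {linear V -> V'}) (g : {linear W -> W'}) t :
  tens_map f g t = \sw_(v, w <- t) (f v \ox g w).
Proof. by []. Qed.

Lemma sweedler_map (V W V' W' U : lmodType k)
    (f : {linear V -> V'}) (g : {linear W -> W'}) t (F : V' -> W' -> U) :
  bilin F -> sweedler (tens_map f g t) F = \sw_(v, w <- t) F (f v) (g w).
Proof.
move=> bF; rewrite tens_mapE sweedler_sweedler //.
by apply: eq_sweedler => v w; rewrite sweedler_pure.
Qed.

End TensorMap.
Section Bilin.
Variables (k : fieldType) (V W X Y U : lmodType k).

Lemma bilin_sweedlerl (F : {linear V -> X \Ox Y}) (G : X -> Y -> W -> U) :
  (forall w, bilin (fun x y => G x y w)) -> (forall x y, linear (G x y)) ->
  bilin (fun v w => \sw_(x, y <- F v) G x y w).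
Proof.
move=> bG lG; split=> [w|v] a p q; last exact: sweedler_lin.
by rewrite linearP (sweedler_linear (bG w)).
Qed.

Lemma bilin_sweedlerr (F : {linear W -> X \Ox Y}) (G : X -> Y -> V -> U) :
  (forall v, bilin (fun x y => G x y v)) -> (forall x y, linear (G x y)) ->
  bilin (fun v w => \sw_(x, y <- F w) G x y v).
Proof.
move=> bG lG; split=> [w|v] a p q; first exact: sweedler_lin.
by rewrite linearP (sweedler_linear (bG v)).
Qed.

End Bilin.

Lemma pureP_l (k : fieldType) (V W : lmodType k) a (v v' : V) (w : W) :
  (a *: v + v') \ox w = a *: (v \ox w) + v' \ox w.
Proof. by rewrite pureDl pureZl. Qed.
Lemma pureP_r (k : fieldType) (V W : lmodType k) a (v : V) (w w' : W) :
  v \ox (a *: w + w') = a *: (v \ox w) + v \ox w'.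
Proof. by rewrite pureDr pureZr. Qed.

Lemma scaleP_l (k : fieldType) (V : lmodType k) (a : k) (x y : k^o) (v : V) :
  (a *: x + y : k) *: v = a *: ((x : k) *: v) + (y : k) *: v.
Proof. by rewrite scalerDl scalerA. Qed.
Lemma scaleP_r (k : fieldType) (V : lmodType k) (a b : k) (u v : V) :
  b *: (a *: u + v) = a *: (b *: u) + b *: v.
Proof. by rewrite scalerDr !scalerA mulrC. Qed.

Ltac lin_tac :=
  let a := fresh in let x := fresh in let y := fresh in
  move=> a x y /=; rewrite ?linearP /=;
  rewrite ?(pureP_l, pureP_r, scaleP_l, scaleP_r, linearP) //=.
Ltac bilin_tac :=
  first [ apply: bilin_sweedlerl => [?|? ?] | apply: bilin_sweedlerr => [?|? ?]
        | split=> ? ];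
  first [ done | bilin_tac | lin_tac ].

Section Subspace.
Variables (k : fieldType) (V : lmodType k).

Definition subsp (D : submodClosed V) := {x : V | x \in D}.
HB.instance Definition _ (D : submodClosed V) := SubChoice.on (subsp D).
HB.instance Definition _ (D : submodClosed V) :=
  [SubChoice_isSubLmodule of subsp D by <:].

Definition subsp_incl (D : submodClosed V) : {linear subsp D -> V} := \val.

Lemma subsp_retract_ex (D : submodClosed V) :
  exists r : {linear V -> subsp D}, forall x, r (subsp_incl D x) = x.
Proof.
pose P (A : set V) := (forall a x y, A x -> A y -> A (a *: x + y)) /\
  forall x, A x -> x \in D -> x = 0.
have [F FP Ftot|A [[Alin AD] Amax]] := @Zorn_bigcup V P.
  split=> [a x y [X FX Xx] [Y FY Yy]|x [X /FP[_ XD] Xx]]; last exact: XD.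
  have [XY|YX] := Ftot _ _ FX FY.
    by exists Y => //; apply: (FP _ FY).1 => //; apply: XY.
  by exists X => //; apply: (FP _ FX).1 => //; apply: YX.
have A0 : A 0.
  have [[x Ax]|nA] := pselect (exists x, A x).
    by rewrite -(addNr x) -scaleN1r; apply: Alin.
  exfalso; apply: (Amax [set 0]%classic).
    split=> [x Ax|/(_ 0 erefl) A0]; first by case: nA; exists x.
    by apply: nA; exists 0.
  by split=> [a x y -> ->|x -> //]; rewrite scaler0 addr0.
have AZ a x : A x -> A (a *: x).
  by move=> Ax; rewrite -[_ *: _]addr0; apply: Alin.
have ex v : exists d : subsp D, A (v - val d).
  apply: contrapT => nv.
  have nv' d : d \in D -> ~ A (v - d).
    by move=> dD Ad; apply: nv; exists (Sub d dD); rewrite SubK.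
  apply: (Amax [set x | exists a w, A w /\ x = a *: v + w]%classic).
    split=> [w Aw|BA]; first by exists 0, w; rewrite scale0r add0r.
    apply: (nv' 0); first exact: rpred0.
    by rewrite subr0; apply: BA; exists 1, 0; rewrite scale1r addr0.
  split=> [b _ _ [a [w [Aw ->]]] [a' [w' [Aw' ->]]]|_ [a [w [Aw ->]]]].
    exists (b * a + a'), (b *: w + w'); split; first exact: Alin.
    by rewrite scalerDr scalerDl scalerA addrACA.
  have [->|a0] := eqVneq a 0.
    by rewrite scale0r add0r; apply: AD.
  move=> dD; exfalso; apply: (nv' (a^-1 *: (a *: v + w))); first exact: rpredZ.
  by rewrite scalerDr scalerA mulVf // scale1r opprD addNKr -scalerN -scaleN1r;
    apply/AZ/AZ.
have uniq v (d d' : subsp D) : A (v - val d) -> A (v - val d') -> d = d'.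
  move=> Ad Ad'; apply/val_inj/eqP; rewrite -subr_eq0; apply/eqP/AD.
    have -> : val d - val d' = -1 *: (v - val d) + (v - val d').
      by rewrite scaleN1r opprB addrA subrK.
    exact: Alin.
  by rewrite -scaleN1r; apply: rpredD; [|apply: rpredZ]; apply: valP.
pose r v := projT1 (cid (ex v)).
have rP v : A (v - val (r v)) by apply: projT2 (cid (ex v)).
have r_lin : linear r.
  move=> a x y; apply: (uniq (a *: x + y)) => //.
  have -> : val (a *: r x + r y) = a *: val (r x) + val (r y).
    exact: (linearP (subsp_incl D)).
  by rewrite opprD addrACA -scalerBr; apply: Alin.
by exists (mk_lin r_lin) => x; apply: uniq (rP _) _; rewrite subrr.
Qed.

Definition subsp_retract D : {linear V -> subsp D} :=
  projT1 (cid (subsp_retract_ex D)).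
Lemma subsp_retractK D x : subsp_retract D (subsp_incl D x) = x.
Proof. by rewrite /subsp_retract; case: cid. Qed.

Lemma subsp_inclE D x : subsp_incl D x = val x.
Proof. by []. Qed.

End Subspace.

Lemma lin_compE (k : fieldType) (U V W : lmodType k) (f : {linear V -> W})
    (g : {linear U -> V}) x : (f \o g : {linear U -> W}) x = f (g x).
Proof. by []. Qed.

Lemma tens_map_inj (k : fieldType) (V W V' W' : lmodType k)
    (f : {linear V -> V'}) (g : {linear W -> W'})
    (f' : {linear V' -> V}) (g' : {linear W' -> W}) :
  cancel f f' -> cancel g g' -> cancel (tens_map f g) (tens_map f' g').
Proof.
move=> fK gK; elim/tens_ind => [|v w t IH]; first by rewrite !linear0.
by rewrite !linearD IH !tens_map_pure fK gK.
Qed.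

Section CoalgebraAxioms.
Variables (k : fieldType) (C : lmodType k).
Variables (Delta : {linear C -> C \Ox C}) (eps : {linear C -> k^o}).

Record is_coalgebra : Prop := IsCoalgebra {
  coassoc_ax : forall h,
    \sw_(a, b <- Delta h) \sw_(a1, a2 <- Delta a) (a1 \ox (a2 \ox b)) =
    \sw_(a, b <- Delta h) \sw_(b1, b2 <- Delta b) (a \ox (b1 \ox b2));
  counitl_ax : forall h, \sw_(a, b <- Delta h) (eps a *: b) = h;
  counitr_ax : forall h, \sw_(a, b <- Delta h) (eps b *: a) = h
}.
End CoalgebraAxioms.

Record coalgebra (k : fieldType) := Coalgebra {
  coalg_space :> lmodType k;
  comul : {linear coalg_space -> coalg_space \Ox coalg_space};
  counit : {linear coalg_space -> k^o};
  coalgP : is_coalgebra comul counit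
}.
Arguments comul {k _}.
Arguments counit {k _}.

Record hopfAlgebra (k : fieldType) := HopfAlgebra {
  hopf_alg :> algType k;
  hcomul : {linear hopf_alg -> hopf_alg \Ox hopf_alg};
  hcounit : {linear hopf_alg -> k^o};
  antipode : {linear hopf_alg -> hopf_alg};
  hopf_coalgP : is_coalgebra hcomul hcounit;
  hcomul1 : hcomul 1 = 1 \ox 1;
  hcomulM : forall g h, hcomul (g * h) =
    \sw_(a, b <- hcomul g) \sw_(c, d <- hcomul h) ((a * c) \ox (b * d));
  hcounit1 : hcounit 1 = 1;
  hcounitM : forall g h, hcounit (g * h) = hcounit g * hcounit h :> k;
  antipodel : forall h,
    \sw_(a, b <- hcomul h) (antipode a * b) = hcounit h *: 1;
  antipoder : forall h,
    \sw_(a, b <- hcomul h) (a * antipode b) = hcounit h *: 1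
}.


Arguments hcomul {k _}.
Arguments hcounit {k _}.

Definition hopf_coalg (k : fieldType) (H : hopfAlgebra k) : coalgebra k :=
  Coalgebra (hopf_coalgP H).

Definition right_integral (k : fieldType) (H : hopfAlgebra k)
    (chi : {linear H -> k^o}) :=
  forall h : H, \sw_(a, b <- hcomul h) (chi a *: b) = chi h *: 1.

Section Subcoalgebra.
Variables (k : fieldType) (C : coalgebra k).

Definition is_subcoalgebra (D : submodClosed C) :=
  forall x : subsp D, exists t : subsp D \Ox subsp D,
    comul (subsp_incl D x) = tens_map (subsp_incl D) (subsp_incl D) t.

Record subcoalgebra := Subcoalgebra {
  subcoalg_space :> submodClosed C;
  subcoalgP : is_subcoalgebra subcoalg_space
}.

Variable D : subcoalgebra.
Let i := subsp_incl D.
Let r := subsp_retract D.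
Let iK : cancel i r.
Proof. exact: subsp_retractK. Qed.

(* The restriction of the comultiplication to [D], seen as a map into
   [D \Ox D] through a linear retraction; it does not depend on the
   retraction, see [subcoalg_comulE]. *)
Definition subcoalg_comul : {linear subsp D -> subsp D \Ox subsp D} :=
  tens_map r r \o (comul \o i).
Definition subcoalg_counit : {linear subsp D -> k^o} := counit \o i.

Lemma subcoalg_comulE x :
  tens_map i i (subcoalg_comul x) = comul (i x).
Proof.
have [t e] := subcoalgP x; rewrite [RHS]e; congr (tens_map _ _ _).
by rewrite -[LHS]/(tens_map r r (comul (i x))) [comul _]e; apply: tens_map_inj.
Qed.

Fact subcoalg_is_coalgebra : is_coalgebra subcoalg_comul subcoalg_counit.
Proof.
split=> h.
- apply: (can_inj (tens_map_inj iK (tens_map_inj iK iK))).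
  rewrite !linear_sweedler.
  transitivity (\sw_(a, b <- comul (i h))
                \sw_(a1, a2 <- comul a) (a1 \ox (a2 \ox b))).
    rewrite -subcoalg_comulE sweedler_map; last by bilin_tac.
    apply: eq_sweedler => a b; rewrite linear_sweedler -subcoalg_comulE.
    rewrite sweedler_map; last by bilin_tac.
    by apply: eq_sweedler => a1 a2; rewrite !tens_map_pure.
  rewrite (coassoc_ax (coalgP C)) -subcoalg_comulE sweedler_map; last by bilin_tac.
  apply: eq_sweedler => a b; rewrite linear_sweedler -subcoalg_comulE.
  rewrite sweedler_map; last by bilin_tac.
  by apply: eq_sweedler => a1 a2; rewrite !tens_map_pure.
- apply: (can_inj iK); rewrite linear_sweedler.
  rewrite -[RHS](counitl_ax (coalgP C)) -subcoalg_comulE.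
  rewrite sweedler_map; last by bilin_tac.
  by apply: eq_sweedler => a b; rewrite linearZ.
- apply: (can_inj iK); rewrite linear_sweedler.
  rewrite -[RHS](counitr_ax (coalgP C)) -subcoalg_comulE.
  rewrite sweedler_map; last by bilin_tac.
  by apply: eq_sweedler => a b; rewrite linearZ.
Qed.

Definition subcoalg_coalg : coalgebra k := Coalgebra subcoalg_is_coalgebra.

Definition subcoalg_incl : {linear subcoalg_coalg -> C} := i.

End Subcoalgebra.

Definition simple_coalgebra (k : fieldType) (C : coalgebra k) :=
  (exists x : C, x != 0) /\
  forall D : subcoalgebra C,
    (forall x : C, x \in D -> x = 0) \/ (forall x : C, x \in D).

Definition finite_dimensional (k : fieldType) (V : lmodType k) :=
  exists (n : nat) (e : 'I_n -> V),
    forall x, exists! c : {ffun 'I_n -> k}, x = \sum_i c i *: e i.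

#[local] Obligation Tactic := idtac.

Record category := Category {
  ob :> Type;
  arrow : ob -> ob -> Type;
  idm : forall x, arrow x x;
  compm : forall x y z, arrow y z -> arrow x y -> arrow x z;
  compmA : forall x y z t (f : arrow z t) (g : arrow y z) (h : arrow x y),
    compm f (compm g h) = compm (compm f g) h;
  comp1m : forall x y (f : arrow x y), compm (idm y) f = f;
  compm1 : forall x y (f : arrow x y), compm f (idm x) = f
}.
Arguments idm {c} x.

Definition isomorphism (A : category) (x y : A) (f : arrow x y) :=
  exists g : arrow y x, compm f g = idm y /\ compm g f = idm x.

Definition isomorphic (A : category) (x y : A) :=
  exists f : arrow x y, isomorphism f.

Record functor (A B : category) := Functor {
  fob :> A -> B;
  fmap : forall x y, arrow x y -> arrow (fob x) (fob y);
  fmap1 : forall x, fmap (idm x) = idm (fob x);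
  fmapM : forall x y z (f : arrow y z) (g : arrow x y),
    fmap (compm f g) = compm (fmap f) (fmap g)
}.

Definition idF (A : category) : functor A A :=
  @Functor A A id (fun _ _ => id) (fun=> erefl) (fun _ _ _ _ _ => erefl).

Program Definition compF (A B C : category) (G : functor B C)
    (F : functor A B) : functor A C :=
  @Functor A C (fun x => G (F x)) (fun _ _ f => fmap G (fmap F f)) _ _.
Next Obligation. by move=> * /=; rewrite !fmap1. Qed.
Next Obligation. by move=> * /=; rewrite !fmapM. Qed.

Definition naturally_isomorphic (A B : category) (F G : functor A B) :=
  exists2 eta : forall x, arrow (F x) (G x),
    (forall x, isomorphism (eta x)) &
    (forall x y (f : arrow x y),
       compm (eta y) (fmap F f) = compm (fmap G f) (eta x)).

Definition equivalence (A B : category) (F : functor A B) :=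
  exists G : functor B A,
    naturally_isomorphic (compF G F) (idF A) /\
    naturally_isomorphic (compF F G) (idF B).

Program Definition prod_cat (I : Type) (A : I -> category) : category :=
  @Category (forall i, A i) (fun x y => forall i, arrow (x i) (y i))
    (fun x i => idm (x i)) (fun _ _ _ f g i => compm (f i) (g i)) _ _ _.
Next Obligation. by move=> *; apply: functional_extensionality_dep => i; rewrite compmA. Qed.
Next Obligation. by move=> *; apply: functional_extensionality_dep => i; rewrite comp1m. Qed.
Next Obligation. by move=> *; apply: functional_extensionality_dep => i; rewrite compm1. Qed.

Record comodule (k : fieldType) (C : coalgebra k) := Comodule {
  comod_space :> lmodType k;
  coact : {linear comod_space -> comod_space \Ox C};
  coactA : forall m,
    \sw_(a, c <- coact m) \sw_(a0, a1 <- coact a) (a0 \ox (a1 \ox c)) =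
    \sw_(a, c <- coact m) \sw_(c1, c2 <- comul c) (a \ox (c1 \ox c2));
  coact1 : forall m, \sw_(a, c <- coact m) (counit c *: a) = m
}.
Arguments coact {k C _}.

Section ComoduleCategory.
Variables (k : fieldType) (C : coalgebra k).

Record comod_hom (M N : comodule C) := ComodHom {
  comod_fun :> {linear M -> N};
  comod_funP : forall m,
    coact (comod_fun m) = \sw_(a, c <- coact m) (comod_fun a \ox c)
}.

Lemma comod_hom_ext M N (f g : comod_hom M N) : f =1 g -> f = g.
Proof.
case: f g => [f fP] [g gP] /= /lin_ext fg; subst g.
by rewrite (Prop_irrelevance fP gP).
Qed.

Program Definition comod_id (M : comodule C) : comod_hom M M :=
  @ComodHom M M idfun _.
Next Obligation. by move=> M m /=; rewrite sweedler_id. Qed.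

Program Definition comod_comp (M N P : comodule C)
    (f : comod_hom N P) (g : comod_hom M N) : comod_hom M P :=
  @ComodHom M P (comod_fun f \o comod_fun g) _.
Next Obligation.
move=> M N P f g m /=; rewrite comod_funP comod_funP sweedler_sweedler.
  by apply: eq_sweedler => a c; rewrite sweedler_pure //; bilin_tac.
by bilin_tac.
Qed.

Program Definition comod_cat : category :=
  @Category (comodule C) comod_hom comod_id comod_comp _ _ _.
Next Obligation. by move=> *; apply: comod_hom_ext. Qed.
Next Obligation. by move=> *; apply: comod_hom_ext. Qed.
Next Obligation. by move=> *; apply: comod_hom_ext. Qed.

End ComoduleCategory.

Section Curry.
Variables (k : fieldType) (V W U : lmodType k).

Definition curry_fun (f : {linear V \Ox W -> U}) (v : V) : {linear W -> U} :=
  f \o purel W v.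
Fact curry_linear f : linear (curry_fun f).
Proof.
by move=> a x y; apply: lin_ext => w /=; rewrite pureP_l linearP.
Qed.
Definition curry (f : {linear V \Ox W -> U}) : {linear V -> {linear W -> U}} :=
  mk_lin (curry_linear f).
Lemma curryE f v w : curry f v w = f (v \ox w).
Proof. by []. Qed.

Fact rank1_linear (chi : {linear V -> k^o}) (u : U) :
  linear (fun v => chi v *: u).
Proof. by lin_tac. Qed.
Definition rank1 (chi : {linear V -> k^o}) (u : U) : {linear V -> U} :=
  mk_lin (rank1_linear chi u).

End Curry.

Record contramodule (k : fieldType) (C : coalgebra k) := Contramodule {
  contra_space :> lmodType k;
  contra_act : {linear {linear C -> contra_space} -> contra_space};
  contra_actA : forall f : {linear C \Ox C -> contra_space},
    contra_act (contra_act \o curry f) = contra_act (f \o comul);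
  contra_act1 : forall n, contra_act (rank1 counit n) = n
}.
Arguments contra_act {k C _}.

Section ContramoduleCategory.
Variables (k : fieldType) (C : coalgebra k).

Record contra_hom (M N : contramodule C) := ContraHom {
  contra_fun :> {linear M -> N};
  contra_funP : forall f : {linear C -> M},
    contra_fun (contra_act f) = contra_act (contra_fun \o f)
}.

Lemma contra_hom_ext M N (f g : contra_hom M N) : f =1 g -> f = g.
Proof.
case: f g => [f fP] [g gP] /= /lin_ext fg; subst g.
by rewrite (Prop_irrelevance fP gP).
Qed.

Program Definition contra_id (M : contramodule C) : contra_hom M M :=
  @ContraHom M M idfun _.
Next Obligation. by move=> M f /=; congr (contra_act _); apply: lin_ext. Qed.

Program Definition contra_comp (M N P : contramodule C)
    (f : contra_hom N P) (g : contra_hom M N) : contra_hom M P :=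
  @ContraHom M P (contra_fun f \o contra_fun g) _.
Next Obligation.
move=> M N P f g h /=; rewrite !contra_funP.
by congr (contra_act _); apply: lin_ext.
Qed.

Program Definition contra_cat : category :=
  @Category (contramodule C) contra_hom contra_id contra_comp _ _ _.
Next Obligation. by move=> *; apply: contra_hom_ext. Qed.
Next Obligation. by move=> *; apply: contra_hom_ext. Qed.
Next Obligation. by move=> *; apply: contra_hom_ext. Qed.

End ContramoduleCategory.

Section DependentProduct.
Variables (k : fieldType) (I : choiceType) (M : I -> lmodType k).

Definition dprod := forall i, M i.
HB.instance Definition _ := gen_eqMixin dprod.
HB.instance Definition _ := gen_choiceMixin dprod.

Lemma dprod_ext (x y : dprod) : (forall i, x i = y i) -> x = y.
Proof. exact: functional_extensionality_dep. Qed.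

Definition dprod0 : dprod := fun=> 0.
Definition dprodD (x y : dprod) : dprod := fun i => x i + y i.
Definition dprodN (x : dprod) : dprod := fun i => - x i.
Definition dprodZ (a : k) (x : dprod) : dprod := fun i => a *: x i.

Fact dprodDA : associative dprodD.
Proof. by move=> x y z; apply: dprod_ext => i; apply: addrA. Qed.
Fact dprodDC : commutative dprodD.
Proof. by move=> x y; apply: dprod_ext => i; apply: addrC. Qed.
Fact dprod0D : left_id dprod0 dprodD.
Proof. by move=> x; apply: dprod_ext => i; apply: add0r. Qed.
Fact dprodND : left_inverse dprod0 dprodN dprodD.
Proof. by move=> x; apply: dprod_ext => i; apply: addNr. Qed.
HB.instance Definition _ :=
  GRing.isZmodule.Build dprod dprodDA dprodDC dprod0D dprodND.

Fact dprodZA a b x : dprodZ a (dprodZ b x) = dprodZ (a * b) x.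
Proof. by apply: dprod_ext => i; apply: scalerA. Qed.
Fact dprod1Z : left_id 1 dprodZ.
Proof. by move=> x; apply: dprod_ext => i; apply: scale1r. Qed.
Fact dprodZDr : right_distributive dprodZ +%R.
Proof. by move=> a x y; apply: dprod_ext => i; apply: scalerDr. Qed.
Fact dprodZDl x : {morph dprodZ^~ x : a b / a + b}.
Proof. by move=> a b; apply: dprod_ext => i; apply: scalerDl. Qed.
HB.instance Definition _ :=
  GRing.Zmodule_isLmodule.Build k dprod dprodZA dprod1Z dprodZDr dprodZDl.

Fact dprod_proj_linear i : linear (fun x : dprod => x i).
Proof. by []. Qed.
Definition dprod_proj i : {linear dprod -> M i} := mk_lin (dprod_proj_linear i).

Fact dprod_pair_linear (U : lmodType k) (f : forall i, {linear U -> M i}) :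
  linear (fun u => (fun i => f i u) : dprod).
Proof. by move=> a x y; apply: dprod_ext => i; rewrite linearP. Qed.
Definition dprod_pair (U : lmodType k) (f : forall i, {linear U -> M i}) :
  {linear U -> dprod} := mk_lin (dprod_pair_linear f).

Definition fin_supp : {pred dprod} :=
  fun x => `[< finite_set [set i | x i != 0]%classic >].

Fact fin_supp_submod : submod_closed fin_supp.
Proof.
split=> [|a x y /asboolP fx /asboolP fy]; apply/asboolP.
  by apply: sub_finite_set (finite_set0 I) => i /=; rewrite eqxx.
have: finite_set ([set i | x i != 0] `|` [set i | y i != 0])%classic.
  by rewrite finite_setU.
apply: sub_finite_set => i /=; apply: contra_neqP => /not_orP[].
rewrite -[(_ + _ : dprod) i]/(a *: x i + y i).
by move=> /negP/negPn/eqP -> /negP/negPn/eqP ->; rewrite scaler0 addr0.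
Qed.
HB.instance Definition _ :=
  GRing.isSubmodClosed.Build k dprod fin_supp fin_supp_submod.

Definition dsum := subsp (fin_supp : submodClosed dprod).
HB.instance Definition _ := GRing.SubLmodule.on dsum.

Definition dsum_comp (x : dsum) i : M i := val x i.

Lemma dsum_ext (x y : dsum) :
  (forall i, dsum_comp x i = dsum_comp y i) -> x = y.
Proof. by move=> xy; apply/val_inj/dprod_ext. Qed.

Lemma dsum_compP i : linear (fun x => dsum_comp x i).
Proof. by []. Qed.

Lemma dsum_suppP (x : dsum) :
  exists s : seq I, uniq s /\ forall i, i \notin s -> dsum_comp x i = 0.
Proof.
have /asboolP/finite_seqP[s es] := valP x.
exists (undup s); split=> [|i]; first exact: undup_uniq.
rewrite mem_undup; apply: contraNeq => xi.
by have : [set` s]%classic i by rewrite -es.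
Qed.

Fact dsum_inj_fin i (x : M i) : (dfwith (fun=> 0) x : dprod) \in fin_supp.
Proof.
apply/asboolP; apply: sub_finite_set (finite_set1 i) => j /=.
by case: dfwithP => // l _; rewrite eqxx.
Qed.
Definition dsum_inj_fun i (x : M i) : dsum :=
  @exist dprod _ _ (dsum_inj_fin x).

Lemma dsum_inj_in i (x : M i) : dsum_comp (dsum_inj_fun x) i = x.
Proof. by rewrite /dsum_comp /= dfwith_in. Qed.
Lemma dsum_inj_out i (x : M i) j : i != j -> dsum_comp (dsum_inj_fun x) j = 0.
Proof. by move=> ij; rewrite /dsum_comp /= dfwith_out. Qed.

Fact dsum_inj_linear i : linear (@dsum_inj_fun i).
Proof.
move=> a x y; apply: dsum_ext => j; rewrite dsum_compP.
have [<-|ij] := eqVneq i j; first by rewrite !dsum_inj_in.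
by rewrite !dsum_inj_out // scaler0 addr0.
Qed.
Definition dsum_inj i : {linear M i -> dsum} := mk_lin (@dsum_inj_linear i).

Section Lift.
Variables (U : lmodType k) (f : forall i, {linear M i -> U}).

Definition dsum_lift_fun (x : dsum) : U :=
  \sum_(i \in [set: I]%classic) f i (dsum_comp x i).

Lemma dsum_lift_funE (x : dsum) (s : seq I) :
  uniq s -> (forall i, i \notin s -> dsum_comp x i = 0) ->
  dsum_lift_fun x = \sum_(i <- s) f i (dsum_comp x i).
Proof.
move=> us xs; rewrite /dsum_lift_fun (fsbigE s) //.
  by apply: eq_bigl => i; rewrite in_setT.
by move=> i _ /xs ->; rewrite linear0.
Qed.

Fact dsum_lift_linear : linear dsum_lift_fun.
Proof.
move=> a x y; have [s [us xs]] := dsum_suppP x; have [t [ut yt]] := dsum_suppP y.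
have uu := undup_uniq (s ++ t); set u := undup _ in uu.
have xu i : i \notin u -> dsum_comp x i = 0.
  by rewrite mem_undup mem_cat negb_or => /andP[/xs].
have yu i : i \notin u -> dsum_comp y i = 0.
  by rewrite mem_undup mem_cat negb_or => /andP[_ /yt].
rewrite !(dsum_lift_funE uu) //; last first.
  by move=> i iu; rewrite dsum_compP xu // yu // scaler0 addr0.
rewrite scaler_sumr -big_split /=; apply: eq_bigr => i _.
by rewrite dsum_compP linearP.
Qed.
Definition dsum_lift : {linear dsum -> U} := mk_lin dsum_lift_linear.

Lemma dsum_lift_inj i x : dsum_lift (dsum_inj i x) = f i x.
Proof.
rewrite [LHS](@dsum_lift_funE _ [:: i]) //.
  by rewrite big_seq1 dsum_inj_in.
by move=> j; rewrite inE eq_sym => ij; rewrite dsum_inj_out.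
Qed.
End Lift.

Lemma dsum_decomp (x : dsum) : dsum_lift dsum_inj x = x.
Proof.
have [s [us xs]] := dsum_suppP x; rewrite [LHS](dsum_lift_funE _ us xs).
apply: dsum_ext => j; rewrite [LHS](linear_sum (mk_lin (dsum_compP j))) /=.
have [js|js] := boolP (j \in s).
  rewrite (bigD1_seq j) //= dsum_inj_in big1 ?addr0 // => i ij.
  by rewrite dsum_inj_out.
rewrite xs // big_seq big1 // => i si; rewrite dsum_inj_out //.
by apply: contraNneq js => <-.
Qed.

Lemma lin_dsum_ext (U : lmodType k) (f g : {linear dsum -> U}) :
  (forall i x, f (dsum_inj i x) = g (dsum_inj i x)) -> f =1 g.
Proof.
move=> fg x; rewrite -(dsum_decomp x).
have [s [us xs]] := dsum_suppP x.
rewrite -[dsum_lift _ x]/(dsum_lift_fun _ x) (dsum_lift_funE _ us xs).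
by rewrite !linear_sum; apply: eq_bigr => i _; rewrite fg.
Qed.

End DependentProduct.

Record simple_decomposition (k : fieldType) (H : coalgebra k) := {
  dec_index : choiceType;
  dec_sub : dec_index -> subcoalgebra H;
  dec_finite : forall i, finite_dimensional (subcoalg_coalg (dec_sub i));
  dec_simple : forall i, simple_coalgebra (subcoalg_coalg (dec_sub i));
  dec_direct : bijective (dsum_lift (fun i => subcoalg_incl (dec_sub i)))
}.

Arguments dec_sub {k H} _ _.
Arguments dec_finite {k H} _ _.

Lemma subcoalg_inclP (k : fieldType) (C : coalgebra k) (D : subcoalgebra C)
    (x : subcoalg_coalg D) :
  comul (subcoalg_incl D x) =
  tens_map (subcoalg_incl D) (subcoalg_incl D) (comul x).
Proof. by rewrite [RHS](subcoalg_comulE (D := D)). Qed.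

Section DsumComodule.
Variables (k : fieldType) (H : coalgebra k) (I : choiceType).
Variable C : I -> subcoalgebra H.
Implicit Types M N : forall i, comodule (subcoalg_coalg (C i)).

Definition dsum_coact M :
    {linear dsum (fun i => M i) -> dsum (fun i => M i) \Ox H} :=
  dsum_lift (fun i =>
    tens_map (dsum_inj (fun i => M i) i) (subcoalg_incl (C i)) \o coact).

Lemma dsum_coact_inj M i (x : M i) :
  dsum_coact M (dsum_inj (fun i => M i) i x) =
  tens_map (dsum_inj (fun i => M i) i) (subcoalg_incl (C i)) (coact x).
Proof. by rewrite /dsum_coact dsum_lift_inj. Qed.

Fact dsum_coactA M m :
  \sw_(a, c <- dsum_coact M m) \sw_(a0, a1 <- dsum_coact M a)
    (a0 \ox (a1 \ox c)) =
  \sw_(a, c <- dsum_coact M m) \sw_(c1, c2 <- comul c) (a \ox (c1 \ox c2)).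
Proof.
have bL : bilin (fun a (c : H) => \sw_(a0, a1 <- dsum_coact M a)
    (a0 \ox (a1 \ox c))) by bilin_tac.
have bR : bilin (fun (a : dsum (fun i => M i)) c =>
    \sw_(c1, c2 <- (comul c : H \Ox H)) (a \ox (c1 \ox c2))) by bilin_tac.
pose f := tens_lift bL \o dsum_coact M; pose g := tens_lift bR \o dsum_coact M.
apply: (@lin_dsum_ext _ _ _ _ f g) => i x {m}.
pose y := dsum_coact M (dsum_inj (fun i => M i) i x).
change (tens_lift bL y = tens_lift bR y); rewrite {}/y dsum_coact_inj.
rewrite [LHS]sweedler_map // [RHS]sweedler_map //.
pose J := tens_map (dsum_inj (fun i => M i) i)
  (tens_map (subcoalg_incl (C i)) (subcoalg_incl (C i))).
transitivity (J (\sw_(a, c <- coact x) \sw_(a0, a1 <- coact a)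
                   (a0 \ox (a1 \ox c)))).
  rewrite linear_sweedler; apply: eq_sweedler => a c.
  rewrite linear_sweedler dsum_coact_inj sweedler_map; last by bilin_tac.
  by apply: eq_sweedler => a0 a1; rewrite /J !tens_map_pure.
rewrite coactA linear_sweedler; apply: eq_sweedler => a c.
rewrite linear_sweedler subcoalg_inclP sweedler_map; last by bilin_tac.
by apply: eq_sweedler => a0 a1; rewrite /J !tens_map_pure.
Qed.

Fact dsum_coact1 M m : \sw_(a, c <- dsum_coact M m) (counit c *: a) = m.
Proof.
have b : bilin (fun (a : (dsum (fun i => M i) : lmodType k)) (c : H) =>
    counit c *: a).
  by bilin_tac.
pose f := tens_lift b \o dsum_coact M.
apply: (@lin_dsum_ext _ _ _ _ f idfun) => i x {m}.
pose y := dsum_coact M (dsum_inj (fun i => M i) i x).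
change (tens_lift b y = dsum_inj (fun i => M i) i x).
rewrite {}/y dsum_coact_inj [LHS]sweedler_map //.
rewrite -[in RHS](coact1 x) linear_sweedler.
by apply: eq_sweedler => a c; rewrite linearZ.
Qed.

Definition dsum_comodule M : comodule H :=
  Comodule (@dsum_coactA M) (@dsum_coact1 M).

Definition dsum_map M N (f : forall i, comod_hom (M i) (N i)) :
    {linear dsum (fun i => M i) -> dsum (fun i => N i)} :=
  dsum_lift (fun i => dsum_inj (fun i => N i) i \o comod_fun (f i)).

Lemma dsum_map_inj M N (f : forall i, comod_hom (M i) (N i)) i (x : M i) :
  dsum_map f (dsum_inj (fun i => M i) i x) = dsum_inj (fun i => N i) i (f i x).
Proof. exact: dsum_lift_inj. Qed.

Lemma dsum_map_comp M N (f : forall i, comod_hom (M i) (N i)) x i :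
  dsum_comp (dsum_map f x) i = f i (dsum_comp x i).
Proof.
pose F := mk_lin (dsum_compP (M := fun i => N i) i) \o dsum_map f.
pose G := comod_fun (f i) \o mk_lin (dsum_compP (M := fun i => M i) i).
apply: (@lin_dsum_ext _ _ _ _ F G) => j {}x.
pose y := dsum_inj (fun i => M i) j x.
change (dsum_comp (dsum_map f y) i = f i (dsum_comp y i)).
rewrite {}/y dsum_map_inj.
have [e|ji] := eqVneq j i; last by rewrite !dsum_inj_out // linear0.
by case: i / e {F G}; rewrite !dsum_inj_in.
Qed.

Fact dsum_map_comod M N (f : forall i, comod_hom (M i) (N i)) m :
  dsum_coact N (dsum_map f m) =
  \sw_(a, c <- dsum_coact M m) (dsum_map f a \ox c).
Proof.
pose F := dsum_coact N \o dsum_map f.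
pose G := tens_map (dsum_map f) idfun \o dsum_coact M.
apply: (@lin_dsum_ext _ _ _ _ F G) => i x.
pose y := dsum_inj (fun i => M i) i x.
change (dsum_coact N (dsum_map f y) =
        tens_map (dsum_map f) idfun (dsum_coact M y)).
rewrite {}/y dsum_coact_inj dsum_map_inj dsum_coact_inj comod_funP.
rewrite linear_sweedler [RHS]sweedler_map; last exact: tens_map_bilin.
by apply: eq_sweedler => a c; rewrite tens_map_pure dsum_map_inj.
Qed.

Definition dsum_comod_map M N (f : forall i, comod_hom (M i) (N i)) :
    comod_hom (dsum_comodule M) (dsum_comodule N) :=
  @ComodHom _ _ (dsum_comodule M) (dsum_comodule N) _ (dsum_map_comod f).

Program Definition dsum_functor :
    functor (prod_cat (fun i => comod_cat (subcoalg_coalg (C i))))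
            (comod_cat H) :=
  @Functor (prod_cat (fun i => comod_cat (subcoalg_coalg (C i))))
    (comod_cat H) dsum_comodule dsum_comod_map _ _.
Next Obligation.
move=> M; apply: comod_hom_ext => x; apply: dsum_ext => i.
exact: dsum_map_comp.
Qed.
Next Obligation.
move=> M N P f g; apply: comod_hom_ext => x; apply: dsum_ext => i.
rewrite [LHS]dsum_map_comp; apply/esym.
change (dsum_comp (dsum_map f (dsum_map g x)) i = f i (g i (dsum_comp x i))).
by rewrite !dsum_map_comp.
Qed.

End DsumComodule.

Section FiniteDimensional.
Variables (k : fieldType) (V : lmodType k) (fdV : finite_dimensional V).

Definition fd_dim : nat := projT1 (cid fdV).
Definition fd_basis : 'I_fd_dim -> V := projT1 (cid (projT2 (cid fdV))).

Lemma fd_coord_ex x :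
  exists! c : {ffun 'I_fd_dim -> k}, x = \sum_i c i *: fd_basis i.
Proof. exact: projT2 (cid (projT2 (cid fdV))) x. Qed.

Definition fd_coord_fun x : {ffun 'I_fd_dim -> k} :=
  projT1 (cid (fd_coord_ex x)).
Lemma fd_coord_funE x : x = \sum_i fd_coord_fun x i *: fd_basis i.
Proof. exact: (projT2 (cid (fd_coord_ex x))).1. Qed.

Fact fd_coord_linear i : linear (fun x => fd_coord_fun x i : k^o).
Proof.
move=> a x y; pose c := [ffun i => a * fd_coord_fun x i + fd_coord_fun y i].
suff -> : fd_coord_fun (a *: x + y) = c by rewrite ffunE.
apply: (projT2 (cid (fd_coord_ex (a *: x + y)))).2.
rewrite {1}(fd_coord_funE x) {1}(fd_coord_funE y) scaler_sumr -big_split /=.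
by apply: eq_bigr => j _; rewrite ffunE scalerDl scalerA.
Qed.
Definition fd_coord i : {linear V -> k^o} := mk_lin (fd_coord_linear i).

Lemma fd_coordE x : x = \sum_i (fd_coord i x : k) *: fd_basis i.
Proof. exact: fd_coord_funE. Qed.

Variable M : lmodType k.

Fact hom_tens_bilin :
  bilin (fun (m : M) (chi : {linear V -> k^o}) => rank1 chi m).
Proof.
split=> [chi|m] a x y; apply: lin_ext => v.
  exact: scaleP_r.
exact: scaleP_l.
Qed.

(* [hom_tens] is the canonical isomorphism from [M \Ox V^*] to [Hom(V, M)],
   and [hom_tens_inv] its inverse, written in dual bases. *)
Definition hom_tens :
    {linear M \Ox {linear V -> k^o} -> {linear V -> M}} :=
  tens_lift hom_tens_bilin.

Definition hom_tens_inv_fun (f : {linear V -> M}) : M \Ox {linear V -> k^o} :=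
  \sum_i f (fd_basis i) \ox fd_coord i.
Fact hom_tens_inv_linear : linear hom_tens_inv_fun.
Proof.
move=> a f g; rewrite /hom_tens_inv_fun scaler_sumr -big_split /=.
by apply: eq_bigr => i _; rewrite pureP_l.
Qed.
Definition hom_tens_inv :
    {linear {linear V -> M} -> M \Ox {linear V -> k^o}} :=
  mk_lin hom_tens_inv_linear.

Lemma lin_sumE (J : finType) (U W : lmodType k) (F : J -> {linear U -> W}) x :
  (\sum_j F j) x = \sum_j F j x.
Proof. by apply: (big_ind2 (fun (f : {linear U -> W}) y => f x = y)) => // ? ? ? ? <- <-. Qed.

Lemma hom_tens_invK : cancel hom_tens_inv hom_tens.
Proof.
move=> f; apply: lin_ext => v; rewrite [hom_tens _](linear_sum hom_tens).
rewrite lin_sumE {2}(fd_coordE v) linear_sum; apply: eq_bigr => i _.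
by rewrite /hom_tens tens_lift_pure linearZ.
Qed.

Lemma hom_tensK : cancel hom_tens hom_tens_inv.
Proof.
elim/tens_ind => [|m chi t IH]; first by rewrite !linear0.
rewrite !linearD IH; congr (_ + _).
rewrite /hom_tens tens_lift_pure -[LHS]/(hom_tens_inv_fun _) /hom_tens_inv_fun.
have {2}-> : chi = \sum_i (chi (fd_basis i) : k) *: fd_coord i.
  apply: lin_ext => v; rewrite lin_sumE {1}(fd_coordE v) linear_sum.
  by apply: eq_bigr => i _; rewrite linearZ; apply: mulrC.
rewrite [RHS](linear_sum (purel _ m)); apply: eq_bigr => i _.
by rewrite /rank1 /purel !mk_linE pureZl pureZr.
Qed.

End FiniteDimensional.
Arguments fd_basis {k V} fdV i.
Arguments fd_coord {k V} fdV i.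
Arguments fd_coordE {k V} fdV x.

Section FiniteContramodule.
Variables (k : fieldType) (C : coalgebra k) (fdC : finite_dimensional C).
Implicit Types M N : comodule C.

Definition dual_act M (m : M) (chi : {linear C -> k^o}) : M :=
  \sw_(m0, m1 <- coact m) (chi m1 *: m0).

Fact dual_act_bilin M : bilin (@dual_act M).
Proof.
split=> [chi|m] a x y; rewrite /dual_act.
  by rewrite linearP sweedler_linear //; bilin_tac.
pose F (m0 : M) (m1 : C) (psi : {linear C -> k^o}) := (psi m1 : k) *: m0.
apply: (@sweedler_lin k M C {linear C -> k^o} M (coact m) F) => m0 m1 b u v.
exact: scaleP_l.
Qed.

Definition fd_contra_act M : {linear {linear C -> M} -> M} :=
  tens_lift (@dual_act_bilin M) \o hom_tens_inv fdC M.

Lemma fd_contra_actE M (f : {linear C -> M}) :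
  fd_contra_act M f = \sum_i dual_act (f (fd_basis fdC i)) (fd_coord fdC i).
Proof.
rewrite -[LHS]/(tens_lift (@dual_act_bilin M) (hom_tens_inv_fun fdC f)).
by rewrite linear_sum; apply: eq_bigr => i _; rewrite tens_lift_pure.
Qed.

Lemma fd_contra_act_rank1 M (chi : {linear C -> k^o}) (m : M) :
  fd_contra_act M (rank1 chi m) = dual_act m chi.
Proof.
have <- : hom_tens C M (m \ox chi) = rank1 chi m by rewrite /hom_tens tens_lift_pure.
rewrite -[LHS]/(tens_lift (@dual_act_bilin M) (hom_tens_inv fdC M (hom_tens C M (m \ox chi)))).
by rewrite hom_tensK tens_lift_pure.
Qed.

Fact fd_contra_act1 M (n : M) : fd_contra_act M (rank1 counit n) = n.
Proof. by rewrite fd_contra_act_rank1 /dual_act coact1. Qed.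

Lemma conv_bilin (chi psi : {linear C -> k^o}) :
  bilin (fun x y => (chi x * psi y : k^o)).
Proof.
split=> [w|v] a x y; rewrite linearP.
  exact: (@scaleP_l k k^o a (chi x) (chi y) (psi w)).
exact: (@scaleP_r k k^o a (chi v) (psi x) (psi y)).
Qed.

Fact fd_contra_actA M (f : {linear C \Ox C -> M}) :
  fd_contra_act M (fd_contra_act M \o curry f) = fd_contra_act M (f \o comul).
Proof.
pose e := fd_basis fdC; pose e' := fd_coord fdC.
pose T i j := rank1 (tens_lift (conv_bilin (e' i) (e' j))) (f (e i \ox e j)).
have -> : f = \sum_i \sum_j T i j.
  apply/lin_ext/lin_tens_ext => x y; rewrite lin_sumE.
  rewrite {1}(fd_coordE fdC x) {1}(fd_coordE fdC y).
  rewrite -[_ \ox _]/(purer _ _ _) linear_sum linear_sum; apply: eq_bigr => i _.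
  rewrite lin_sumE /purer mk_linE -[_ \ox _]/(purel _ _ _) !linear_sum.
  apply: eq_bigr => j _; rewrite /purel mk_linE pureZl pureZr scalerA linearZ.
  by rewrite /T /rank1 mk_linE tens_lift_pure.
pose L (g : {linear C \Ox C -> M}) := fd_contra_act M (fd_contra_act M \o curry g).
pose R (g : {linear C \Ox C -> M}) := fd_contra_act M (g \o comul).
have LD g h : L (g + h) = L g + L h.
  rewrite /L -linearD; congr (fd_contra_act M _); apply: lin_ext => x.
  rewrite -[RHS](linearD (fd_contra_act M) (curry g x) (curry h x)).
  rewrite -[LHS]/(fd_contra_act M (curry (g + h) x)).
  by congr (fd_contra_act M _); apply: lin_ext.
have RD g h : R (g + h) = R g + R h.
  by rewrite /R -linearD; congr (fd_contra_act M _); apply: lin_ext.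
have L0 : L 0 = 0 by apply: (addrI (L 0)); rewrite -LD !addr0.
have R0 : R 0 = 0 by apply: (addrI (R 0)); rewrite -RD !addr0.
rewrite -/(L _) -/(R _).
apply: (big_ind (fun g => L g = R g)) => [|g h|i _]; first by rewrite L0 R0.
  by rewrite LD RD => -> ->.
apply: (big_ind (fun g => L g = R g)) => [|g h|j _]; first by rewrite L0 R0.
  by rewrite LD RD => -> ->.
rewrite /L /R {}/T; move: (f _) (e' i) (e' j) => m chi psi {L R LD RD L0 R0 e e' f}.
rewrite [X in fd_contra_act M X = _](_ : _ = rank1 chi (dual_act m psi)); last first.
  apply: lin_ext => x; rewrite -[LHS]/(fd_contra_act M (curry _ x)).
  rewrite -fd_contra_act_rank1 [RHS]mk_linE -linearZ; congr (fd_contra_act M _).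
  by apply: lin_ext => y; rewrite curryE linZE !mk_linE sweedler_pure ?scalerA //;
    apply: conv_bilin.
pose cp : {linear C -> k^o} := tens_lift (conv_bilin chi psi) \o comul.
rewrite [X in _ = fd_contra_act M X](_ : _ = rank1 cp m); last exact: lin_ext.
rewrite !fd_contra_act_rank1.
pose th := tens_lift (conv_bilin chi psi).
have thE x y : th (x \ox y) = chi x * psi y by apply: tens_lift_pure.
have {}cpE c : cp c = th (comul c) by [].
move: th thE cpE => th thE cpE.
have bA : bilin (fun (a : M) (t : C \Ox C) => th t *: a) by bilin_tac.
have bC : bilin (fun (a : M) (c : C) => chi c *: a) by bilin_tac.
have eA := congr1 (tens_lift bA) (coactA m).
rewrite !(linear_sweedler (tens_lift bA)) in eA.
rewrite {1}/dual_act {1}/dual_act (linear_sweedler coact).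
rewrite (sweedler_sweedler bC).
transitivity (\sw_(a, c <- coact m)
  tens_lift bA (\sw_(a0, a1 <- coact a) (a0 \ox (a1 \ox c)))).
  apply: eq_sweedler => a c; rewrite linearZZ (sweedlerZ bC).
  rewrite (linear_sweedler (tens_lift bA)) {1}/sweedler scaler_sumr.
  by apply: eq_bigr => p _; rewrite tens_lift_pure thE scalerA mulrC.
rewrite eA; apply: eq_sweedler => a c; rewrite cpE.
rewrite -(linear_sweedler (purel _ a)) sweedler_id.
exact: tens_lift_pure.
Qed.

Definition fd_contramodule M : contramodule C :=
  Contramodule (@fd_contra_actA M) (@fd_contra_act1 M).

Lemma fd_contra_act_hom M N (f : comod_hom M N) (g : {linear C -> M}) :
  f (fd_contra_act M g) = fd_contra_act N (comod_fun f \o g).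
Proof.
rewrite !fd_contra_actE linear_sum; apply: eq_bigr => i _.
rewrite lin_compE; move: (g _) (fd_coord _ _) => m chi; rewrite /dual_act linear_sweedler.
rewrite -[coact _ in RHS]/(coact (f m)) comod_funP.
rewrite sweedler_sweedler; last by bilin_tac.
apply: eq_sweedler => a c; rewrite linearZ sweedler_pure //.
by bilin_tac.
Qed.

End FiniteContramodule.

Section ProductContramodule.
Variables (k : fieldType) (H : coalgebra k) (I : choiceType).
Variable C : I -> subcoalgebra H.
Hypothesis fdC : forall i, finite_dimensional (subcoalg_coalg (C i)).
Implicit Types M N : forall i, comodule (subcoalg_coalg (C i)).

Fact prod_restrict_linear M i :
  linear (fun f : {linear H -> dprod (fun i => M i)} =>
    dprod_proj (fun i => M i) i \o f \o subcoalg_incl (C i)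
    : {linear subcoalg_coalg (C i) -> M i}).
Proof. by move=> a f g; apply: lin_ext. Qed.

Definition prod_restrict M i :
    {linear {linear H -> dprod (fun i => M i)} ->
            {linear subcoalg_coalg (C i) -> M i}} :=
  mk_lin (@prod_restrict_linear M i).

Definition prod_contra_act M :
    {linear {linear H -> dprod (fun i => M i)} -> dprod (fun i => M i)} :=
  dprod_pair (fun i => fd_contra_act (fdC i) (M i) \o prod_restrict M i).

Lemma prod_contra_actE M f i :
  prod_contra_act M f i = fd_contra_act (fdC i) (M i) (prod_restrict M i f).
Proof. by []. Qed.

Fact prod_contra_actA M (f : {linear H \Ox H -> dprod (fun i => M i)}) :
  prod_contra_act M (prod_contra_act M \o curry f) =
  prod_contra_act M (f \o comul).
Proof.
apply: dprod_ext => i; rewrite !prod_contra_actE.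
pose ii := tens_map (subcoalg_incl (C i)) (subcoalg_incl (C i)).
pose g : {linear subcoalg_coalg (C i) \Ox subcoalg_coalg (C i) -> M i} :=
  dprod_proj (fun i => M i) i \o f \o ii.
transitivity (fd_contra_act (fdC i) (M i) (g \o comul)).
  rewrite -fd_contra_actA; congr (fd_contra_act (fdC i) (M i) _).
  apply: lin_ext => x.
  change (prod_contra_act M (curry f (subcoalg_incl (C i) x)) i =
          fd_contra_act (fdC i) (M i) (curry g x)).
  rewrite prod_contra_actE; congr (fd_contra_act (fdC i) (M i) _).
  apply: lin_ext => y; rewrite curryE.
  change (f (subcoalg_incl (C i) x \ox subcoalg_incl (C i) y) i =
          f (ii (x \ox y)) i).
  by rewrite tens_map_pure.
congr (fd_contra_act (fdC i) (M i) _); apply: lin_ext => x.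
change (f (ii (comul x)) i = f (comul (subcoalg_incl (C i) x)) i).
by rewrite subcoalg_inclP.
Qed.

Fact prod_contra_act1 M (n : dprod (fun i => M i)) :
  prod_contra_act M (rank1 counit n) = n.
Proof.
apply: dprod_ext => i; rewrite prod_contra_actE -[RHS](fd_contra_act1 (fdC i)).
by congr (fd_contra_act (fdC i) (M i) _); apply: lin_ext.
Qed.

Definition prod_contramodule M : contramodule H :=
  Contramodule (@prod_contra_actA M) (@prod_contra_act1 M).

Definition prod_map M N (f : forall i, comod_hom (M i) (N i)) :
    {linear dprod (fun i => M i) -> dprod (fun i => N i)} :=
  dprod_pair (fun i => comod_fun (f i) \o dprod_proj (fun i => M i) i).

Lemma prod_mapE M N (f : forall i, comod_hom (M i) (N i)) x i :
  prod_map f x i = f i (x i).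
Proof. by []. Qed.

Fact prod_map_contra M N (f : forall i, comod_hom (M i) (N i))
    (g : {linear H -> dprod (fun i => M i)}) :
  prod_map f (prod_contra_act M g) = prod_contra_act N (prod_map f \o g).
Proof.
apply: dprod_ext => i; rewrite prod_mapE !prod_contra_actE fd_contra_act_hom.
by congr (fd_contra_act (fdC i) (N i) _); apply: lin_ext.
Qed.

Definition prod_contra_map M N (f : forall i, comod_hom (M i) (N i)) :
    contra_hom (prod_contramodule M) (prod_contramodule N) :=
  @ContraHom _ _ (prod_contramodule M) (prod_contramodule N) _
    (prod_map_contra f).

Program Definition prod_functor :
    functor (prod_cat (fun i => comod_cat (subcoalg_coalg (C i))))
            (contra_cat H) :=
  @Functor (prod_cat (fun i => comod_cat (subcoalg_coalg (C i))))
    (contra_cat H) prod_contramodule prod_contra_map _ _.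
Next Obligation. by move=> M; apply: contra_hom_ext. Qed.
Next Obligation. by move=> M N P f g; apply: contra_hom_ext. Qed.

End ProductContramodule.

(* Main.v *)
(** A normalized right integral [chi] makes [b(x, y) = chi(S(x) y)] a
    coseparability form on [H]: [x1 b(x2, y) = b(x, y1) y2] and [b(x1, x2) = eps(x)].
    Averaging a linear projection onto a subcoalgebra with [b] gives a projection
    that commutes with both actions of [H^*], so every subcoalgebra has a
    complement that is a subcoalgebra.  As [H] is the union of its
    finite-dimensional subcoalgebras, it is the direct sum of the simple ones.

    For [H] the direct sum of the [C_i], let [eps_i] be the counit of [C_i] extended
    by zero.  The [eps_i] are orthogonal central idempotents of [H^*].  They
    split a comodule as the direct sum of the [eps_i M], and a contramodule as
    the product of the [eps_i N] with inverse
    [(n_i) |-> alpha(h |-> sum_i eps_i(h) n_i)].  Hence the direct sum and product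
    functors from families of [C_i]-comodules are both equivalences. *)

Require Import Defs.
From HB Require Import structures.
From mathcomp Require Import all_boot all_algebra.
From mathcomp Require Import boolp classical_sets.

Set Implicit Arguments.
Unset Strict Implicit.
Unset Printing Implicit Defensive.

Import GRing.Theory.
Local Open Scope ring_scope.

(** * Equivalences of categories *)

Section Equivalences.

(** Integral invariance moves one leg of [x] over to [y], and the antipode axiom evaluates
    [b(x1, x2)]: this is the origin of the form [b]. A one-sided average of a linear projection is
    visibly compatible with only one of the two actions; two-sided compatibility comes from
    comparing the left and the right average. Subcoalgebras are treated as subspaces stable under
    both actions of the dual, which turns statements about [D \Ox D] into statements about vectors.

    For contramodules the obstacle is that an infinite family [n_i] has no sum in [N]. The
    contraaction stands in for it: each [h] has finitely many components, so the sum under [alpha]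
    is finite. The components are comodules because over a finite-dimensional coalgebra both notions
    amount to modules over the dual algebra. The equivalence itself is the product functor after a
    quasi-inverse of the direct sum functor, so it matches the sum and the product of the same
    family. *)

Lemma equivalence_full_faithful (A B : category) (F : functor A B) :
  (forall x y (g : arrow (F x) (F y)), exists f, fmap F f = g) ->
  (forall x y, injective (@fmap _ _ F x y)) ->
  (forall y, exists x, isomorphic (F x) y) -> equivalence F.
Proof.
move=> full faith surj.
pose G0 y := projT1 (cid (surj y)).
have iso y : {uv : arrow (F (G0 y)) y * arrow y (F (G0 y)) |
    compm uv.1 uv.2 = idm y /\ compm uv.2 uv.1 = idm (F (G0 y))}.
  have [u /cid[v uv]] := cid (projT2 (cid (surj y))).
  by exists (u, v).
pose u y := (projT1 (iso y)).1; pose v y := (projT1 (iso y)).2.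
have uv y : compm (u y) (v y) = idm y by case: (projT2 (iso y)).
have vu y : compm (v y) (u y) = idm _ by case: (projT2 (iso y)).
pose pre x y (g : arrow (F x) (F y)) := projT1 (cid (full x y g)).
have preK x y g : fmap F (@pre x y g) = g by rewrite /pre; case: cid.
pose Gm y y' (f : arrow y y') := pre _ _ (compm (v y') (compm f (u y))).
have Gm1 y : Gm _ _ (idm y) = idm (G0 y).
  by apply: faith; rewrite preK comp1m vu fmap1.
have GmM x y z (f : arrow y z) (g : arrow x y) :
    Gm _ _ (compm f g) = compm (Gm _ _ f) (Gm _ _ g).
  apply: faith; rewrite fmapM !preK.
  by rewrite -!compmA (compmA (u y)) uv comp1m.
exists (Functor Gm1 GmM); split.
  exists (fun x => pre _ _ (u (F x))) => [x|x y f].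
    by exists (pre _ _ (v (F x))); split; apply: faith;
      rewrite fmapM !preK fmap1 ?uv ?vu.
  by apply: faith; rewrite !fmapM /= !preK !compmA uv comp1m.
exists u => [y|x y f]; first by exists (v y); rewrite uv vu.
by rewrite /= preK !compmA uv comp1m.
Qed.

Lemma naturally_isomorphic_refl (A B : category) (F : functor A B) :
  naturally_isomorphic F F.
Proof.
exists (fun x => idm (F x)) => [x|x y f]; last by rewrite comp1m compm1.
by exists (idm (F x)); rewrite comp1m.
Qed.

Lemma naturally_isomorphic_trans (A B : category) (F G K : functor A B) :
  naturally_isomorphic F G -> naturally_isomorphic G K ->
  naturally_isomorphic F K.
Proof.
move=> [a isoa nata] [b isob natb].
exists (fun x => compm (b x) (a x)) => [x|x y f]; last first.
  by rewrite -compmA nata compmA natb compmA.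
have [a' [aa' a'a]] := isoa x; have [b' [bb' b'b]] := isob x.
exists (compm a' b'); split.
  by rewrite -compmA (compmA (a x)) aa' comp1m.
by rewrite -compmA (compmA b') b'b comp1m.
Qed.

Lemma naturally_isomorphic_comp (A B C : category) (F F' : functor A B)
    (G G' : functor B C) :
  naturally_isomorphic F F' -> naturally_isomorphic G G' ->
  naturally_isomorphic (compF G F) (compF G' F').
Proof.
move=> [a isoa nata] [b isob natb].
exists (fun x => compm (b (F' x)) (fmap G (a x))) => [x|x y f]; last first.
  change (compm (compm (b (F' y)) (fmap G (a y))) (fmap G (fmap F f)) =
    compm (fmap G' (fmap F' f)) (compm (b (F' x)) (fmap G (a x)))).
  by rewrite -compmA -(fmapM G) nata fmapM compmA natb -compmA.
have [a' [aa' a'a]] := isoa x; have [b' [bb' b'b]] := isob (F' x).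
exists (compm (fmap G a') b'); split.
  by rewrite -compmA (compmA (fmap G (a x))) -(fmapM G) aa' fmap1 comp1m.
by rewrite -compmA (compmA b') b'b comp1m -(fmapM G) a'a fmap1.
Qed.

Lemma equivalence_span (A B C : category) (F : functor A B) (G : functor A C) :
  equivalence F -> equivalence G ->
  exists K : functor B C, equivalence K /\ naturally_isomorphic (compF K F) G.
Proof.
move=> [F' [F'F FF']] [G' [G'G GG']].
exists (compF G F'); split; last first.
  exact: (naturally_isomorphic_comp F'F (naturally_isomorphic_refl G)).
exists (compF F G'); split.
- apply: naturally_isomorphic_trans FF'.
  (* The middle factor [compF G' G] is contracted to the identity. Rebracketing and dropping [idF]
     hold by conversion, as the object and arrow maps of [compF] compute. *)
  have FG := naturally_isomorphic_comp
    (naturally_isomorphic_comp (naturally_isomorphic_refl F') G'G)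
    (naturally_isomorphic_refl F).
  exact: FG.
- apply: naturally_isomorphic_trans GG'.
  have GF := naturally_isomorphic_comp
    (naturally_isomorphic_comp (naturally_isomorphic_refl G') F'F)
    (naturally_isomorphic_refl G).
  exact: GF.
Qed.

Lemma isomorphic_sym (A : category) (x y : A) :
  isomorphic x y -> isomorphic y x.
Proof. by case=> f [g [fg gf]]; exists g, f. Qed.

End Equivalences.

(** * Linear algebra *)

Section LinearAlgebra.
Variable k : fieldType.
Implicit Types V W U : lmodType k.

Lemma lin_bijective_inv V W (f : {linear V -> W}) : bijective f ->
  exists g : {linear W -> V}, cancel f g /\ cancel g f.
Proof.
case=> g fK gK; suff lg : linear g by exists (mk_lin lg).
by move=> a x y; apply: (can_inj fK); rewrite linearP !gK.
Qed.

Lemma fixed_linear V (p : {linear V -> V}) a x y :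
  p x = x -> p y = y -> p (a *: x + y) = a *: x + y.
Proof. by rewrite linearP => -> ->. Qed.

(** Subspaces are handled as sets, so that intersections, kernels and ranges can be written
    directly; [subspace_of] packs one for use with [subsp]. *)
Definition is_subspace V (A : set V) :=
  A 0 /\ forall a x y, A x -> A y -> A (a *: x + y).

Definition set_pred V (A : set V) : {pred V} := fun x => `[< A x >].

Fact set_pred_submod V (A : set V) : is_subspace A -> submod_closed (set_pred A).
Proof.
case=> A0 AP; split=> [|a x y /asboolP Ax /asboolP Ay]; apply/asboolP=> //.
exact: AP.
Qed.

Definition subspace_of V (A : set V) (sA : is_subspace A) : submodClosed V :=
  HB.pack (set_pred A)
    (GRing.isSubmodClosed.Build k V (set_pred A) (set_pred_submod sA)).

Lemma subspace_ofP V (A : set V) (sA : is_subspace A) x :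
  reflect (A x) (x \in subspace_of sA).
Proof. exact: asboolP. Qed.

(** Take [U] inside [A] of largest dimension; adding the line through any [x] in [A] stays inside
    [A], so it cannot enlarge [U]. *)
Lemma vspace_of_subspace (vT : vectType k) (A : set vT) : is_subspace A ->
  exists U : {vspace vT}, forall x, A x <-> x \in U.
Proof.
case=> A0 AP.
pose P d := `[< exists U : {vspace vT},
  (forall x, x \in U -> A x) /\ \dim U = d >].
have P0 : exists d, P d.
  exists 0%N; apply/asboolP; exists 0%VS; rewrite dimv0; split=> // x.
  by rewrite memv0 => /eqP ->.
have Pmax d : P d -> (d <= \dim {:vT})%N.
  by move=> /asboolP[U [_ <-]]; apply/dimvS/subvf.
case: (ex_maxnP P0 Pmax) => d /asboolP[U [UA dU]] dmax.
exists U => x; split=> [Ax|]; last exact: UA.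
have : P (\dim (U + <[x]>)%VS).
  apply/asboolP; exists (U + <[x]>)%VS; split=> // y /memv_addP[u uU].
  case=> _ /vlineP[a ->] ->; by rewrite addrC; apply: AP; last exact: UA.
move=> /dmax; rewrite -dU => dle.
have /eqP -> : U == (U + <[x]>)%VS by rewrite eqEdim addvSl.
exact: (subvP (addvSr U _)) (memv_line x).
Qed.

(* A basis of [W] is the image of a basis of a complement of the kernel of [phi] in
   the preimage of [W]. *)
Lemma finite_dimensional_subsp (vT : vectType k) V (phi : {linear vT -> V})
    (W : submodClosed V) :
  (forall w, w \in W -> exists u, phi u = w) -> finite_dimensional (subsp W).
Proof.
move=> sur.
have [|U UP] := @vspace_of_subspace vT [set u | phi u \in W]%classic.
  by split=> [|a x y] /=; rewrite ?linear0 ?rpred0 // linearP => *;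
    rewrite rpredD // rpredZ.
have [|K KP] := @vspace_of_subspace vT [set u | phi u = 0]%classic.
  by split=> [|a x y] /=; rewrite ?linear0 // linearP => -> ->; rewrite scaler0 addr0.
pose X := vbasis (U :\: K).
have Xb : basis_of (U :\: K) X by apply: vbasisP.
have XW i : phi X`_i \in W.
  have [iX|iX] := ltnP i (size X).
    by apply/UP/(subvP (diffvSl U K))/(basis_mem Xb)/mem_nth.
  by rewrite nth_default // linear0 rpred0.
exists (\dim (U :\: K)), (fun i => Sub (phi X`_i) (XW i)) => w.
have valE c : val (\sum_(i < \dim (U :\: K)) c i *: (Sub (phi X`_i) (XW i) : subsp W))
    = phi (\sum_i c i *: X`_i).
  rewrite -[LHS]/(subsp_incl W _) !linear_sum; apply: eq_bigr => i _.
  by rewrite linearZ [RHS]linearZ.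
have [u uw] := sur _ (valP w).
have uU : u \in U by apply/UP; rewrite /= uw (valP w).
have /memv_addP[d dD [z]] : u \in (U :\: K + U :&: K)%VS by rewrite addv_diff_cap.
rewrite memv_cap => /andP[_ /KP z0] ud.
exists [ffun i => coord X i d]; split=> [|c wc].
  apply: val_inj; rewrite valE -uw ud linearD z0 addr0.
  by rewrite {1}(coord_basis Xb dD); congr (phi _); apply: eq_bigr => i _; rewrite ffunE.
(* Uniqueness: both vectors lie in the complement [U :\: K] and have the same image under [phi], so
   their difference lies in [K] too and vanishes. *)
have dc : d = \sum_i c i *: X`_i.
  apply/eqP; rewrite -subr_eq0 -memv0 -(capv_diff U K).
  have cD : \sum_i c i *: X`_i \in (U :\: K)%VS.
    rewrite rpred_sum // => i _; rewrite rpredZ //.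
    by apply/(basis_mem Xb)/mem_nth; rewrite size_tuple.
  rewrite memv_cap rpredB //=; apply/KP => /=.
  rewrite linearB /=; apply/eqP; rewrite subr_eq0; apply/eqP.
  by rewrite -valE -wc -uw ud linearD z0 addr0.
apply/ffunP => i; rewrite ffunE dc.
by rewrite coord_sum_free // (basis_free Xb).
Qed.

Lemma range_is_subspace V W (f : {linear V -> W}) : is_subspace (range f).
Proof.
split=> [|a _ _ [u _ <-] [v _ <-]]; first by exists 0; rewrite ?linear0.
by exists (a *: u + v); rewrite ?linearP.
Qed.

Lemma subspace_sum V (A : set V) (J : eqType) (r : seq J) (F : J -> V) :
  is_subspace A -> (forall j, j \in r -> A (F j)) -> A (\sum_(j <- r) F j).
Proof.
move=> sA AF; apply/(subspace_ofP sA); rewrite big_seq.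
by apply: rpred_sum => j jr; apply/subspace_ofP/AF.
Qed.

Lemma subspaceZ V (A : set V) a x : is_subspace A -> A x -> A (a *: x).
Proof. by case=> A0 AP Ax; rewrite -[_ *: _]addr0; apply: AP. Qed.

Lemma subspaceD V (A : set V) x y : is_subspace A -> A x -> A y -> A (x + y).
Proof. by case=> A0 AP Ax; rewrite -[x]scale1r; apply: AP. Qed.

(** The range of [seq_comb s] is the span of [s]; containment in such a range expresses finite
    dimension without choosing a basis. *)
Definition seq_comb_fun V (s : seq V) (u : 'rV[k]_(size s)) : V :=
  \sum_i u 0 i *: s`_i.
Fact seq_comb_linear V (s : seq V) : linear (seq_comb_fun (s := s)).
Proof.
move=> a u v; rewrite /seq_comb_fun scaler_sumr -big_split; apply: eq_bigr => i _ /=.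
by rewrite !mxE scalerDl scalerA.
Qed.
Definition seq_comb V (s : seq V) : {linear 'rV[k]_(size s) -> V} :=
  mk_lin (@seq_comb_linear V s).

Lemma seq_comb_mem V (s : seq V) x : x \in s -> range (seq_comb s) x.
Proof.
move=> /(nthP 0)[i si <-]; exists (delta_mx 0 (Ordinal si)) => //.
rewrite /= /seq_comb_fun (bigD1 (Ordinal si)) //= big1 ?addr0 => [|j ji].
  by rewrite mxE !eqxx scale1r.
by rewrite mxE (negPf ji) andbF scale0r.
Qed.

Lemma lin_inj_surj_bijective V W (f : {linear V -> W}) :
  (forall x, f x = 0 -> x = 0) -> (forall y, exists x, f x = y) -> bijective f.
Proof.
move=> f0 surj; have f_inj : injective f.
  by move=> x y xy; apply/eqP; rewrite -subr_eq0; apply/eqP/f0; rewrite linearB xy subrr.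
have fK y : f (projT1 (cid (surj y))) = y by case: cid.
by exists (fun y => projT1 (cid (surj y))) => // x; apply: f_inj.
Qed.

(* It suffices to test [t] on the coordinates in a basis of the span of its first
   components. *)
Lemma tensor_separation V W (t : V \Ox W) :
  (forall f : {linear V -> k^o}, \sw_(v, w <- t) ((f v : k) *: w) = 0) -> t = 0.
Proof.
move=> t0; pose s := [seq p.1 | p <- repr t]; pose phi := seq_comb s.
pose D := subspace_of (range_is_subspace phi).
have fdD : finite_dimensional (subsp D).
  apply: (finite_dimensional_subsp (phi := phi)) => w /subspace_ofP[u _ <-].
  by exists u.
pose r := subsp_retract D.
(* Only the first components in the chosen representative of [t] are known to lie in [D], hence
   [eq_big_seq] rather than [eq_sweedler]. *)
have -> : t = \sw_(v, w <- t) (subsp_incl D (r v) \ox w).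
  rewrite -[LHS]sweedler_id /sweedler; apply: eq_big_seq => q tq; congr (_ \ox _).
  have qD : q.1 \in D by apply/subspace_ofP/seq_comb_mem/map_f.
  by rewrite -[q.1](SubK (subsp D) qD) -!subsp_inclE subsp_retractK.
transitivity (\sum_i subsp_incl D (fd_basis fdD i) \ox
    \sw_(v, w <- t) ((fd_coord fdD i (r v) : k) *: w)).
  rewrite /sweedler; under [RHS]eq_bigr => i _ do rewrite -[_ \ox _]/(purel _ _ _) linear_sum.
  rewrite exchange_big /=; apply: eq_bigr => p _.
  rewrite -[LHS]/(purer V p.2 (subsp_incl D (r p.1))).
  rewrite {1}(fd_coordE fdD (r p.1)) !linear_sum.
  by apply: eq_bigr => i _; rewrite !linearZZ pureZr.
by rewrite big1 // => i _; rewrite (t0 (fd_coord fdD i \o r)) -[_ \ox 0]/(purel _ _ 0) linear0.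
Qed.

Lemma tensor_separation_r V W (t : V \Ox W) :
  (forall f : {linear W -> k^o}, \sw_(v, w <- t) ((f w : k) *: v) = 0) -> t = 0.
Proof.
move=> t0; have bS (A B : lmodType k) : bilin (fun (v : A) (w : B) => w \ox v) by bilin_tac.
have sK : cancel (tens_lift (bS V W)) (tens_lift (bS W V)).
  elim/tens_ind => [|v w u IH]; first by rewrite !linear0.
  by rewrite !linearD IH !tens_lift_pure.
apply: (can_inj sK); rewrite linear0; apply: tensor_separation => f.
rewrite sweedler_sweedler; last by bilin_tac.
by rewrite -[RHS](t0 f); apply: eq_sweedler => v w; rewrite sweedler_pure //; bilin_tac.
Qed.

End LinearAlgebra.

(** * Coseparable coalgebras *)

Section TrilinearSweedler.
Variables (k : fieldType) (C : coalgebra k).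

Definition trilin (X Y Z U : lmodType k) (F : X -> Y -> Z -> U) :=
  (forall z, bilin (fun x y => F x y z)) /\ (forall x y, linear (F x y)).

Lemma trilin_lift_bilin (X Y Z U : lmodType k) (F : X -> Y -> Z -> U) :
  trilin F -> bilin (fun x (t : Y \Ox Z) => \sw_(y, z <- t) F x y z).
Proof.
case=> bF lF; split=> [t|x].
  by apply: (sweedler_lin t (f := fun y z x => F x y z)) => y z; apply: (bF z).1.
by apply: sweedler_linear; split=> [z|y]; [apply: (bF z).2 | apply: lF].
Qed.

Lemma trilin_bilinr (X Y Z U : lmodType k) (F : X -> Y -> Z -> U) x :
  trilin F -> bilin (F x).
Proof. by case=> bF lF; split=> [z|y]; [apply: (bF z).2 | apply: lF]. Qed.

(** A trilinear [F] factors through [C \Ox (C \Ox C)] by [G], so the coassociativity axiom can be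
    applied under [F]. *)
Lemma coassoc3 (U : lmodType k) (F : C -> C -> C -> U) h : trilin F ->
  \sw_(a, b <- comul h) \sw_(a1, a2 <- comul a) F a1 a2 b =
  \sw_(a, b <- comul h) \sw_(b1, b2 <- comul b) F a b1 b2.
Proof.
move=> tF; pose G := tens_lift (trilin_lift_bilin tF).
have GE a b c : G (a \ox (b \ox c)) = F a b c.
  rewrite /G tens_lift_pure sweedler_pure //; exact: trilin_bilinr.
have := congr1 G (coassoc_ax (coalgP C) h); rewrite !linear_sweedler.
under eq_sweedler => a b do
  (rewrite linear_sweedler; under eq_sweedler => a1 a2 do rewrite GE).
under [RHS]eq_sweedler => a b do
  (rewrite linear_sweedler; under eq_sweedler => a1 a2 do rewrite GE).
by [].
Qed.

Lemma sweedler_scaler (V W U : lmodType k) (t : V \Ox W) (c : k) (F : V -> W -> U) :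
  c *: sweedler t F = \sw_(a, b <- t) (c *: F a b).
Proof. exact: scaler_sumr. Qed.

Lemma sweedler_scalel (V W U : lmodType k) (t : V \Ox W) (F : V -> W -> k^o) (u : U) :
  (sweedler t F : k) *: u = \sw_(a, b <- t) ((F a b : k) *: u).
Proof. exact: scaler_suml. Qed.

End TrilinearSweedler.

(** * Actions of the dual; subcoalgebras as stable subspaces *)

Section DualActions.
Variables (k : fieldType) (C : coalgebra k).
Implicit Types f g : {linear C -> k^o}.

(* The coalgebra axioms are stated with scalars in the ring [k^o]; restating them
   over [k] makes the lemmas on scaling applicable. *)
Lemma counitl (h : C) : \sw_(a, b <- comul h) ((counit a : k) *: b) = h.
Proof. exact: counitl_ax (coalgP C) h. Qed.
Lemma counitr (h : C) : \sw_(a, b <- comul h) ((counit b : k) *: a) = h.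
Proof. exact: counitr_ax (coalgP C) h. Qed.

Fact lact_bilin f : bilin (fun a b : C => (f a : k) *: b).
Proof. by bilin_tac. Qed.
Fact ract_bilin f : bilin (fun a b : C => (f b : k) *: a).
Proof. by bilin_tac. Qed.

(** Named after the leg that [f] consumes: for the convolution product, [lact] is the standard right
    action and [ract] the standard left one. *)
Definition lact f : {linear C -> C} := tens_lift (lact_bilin f) \o comul.
Definition ract f : {linear C -> C} := tens_lift (ract_bilin f) \o comul.

Lemma lactE f x : lact f x = \sw_(a, b <- comul x) ((f a : k) *: b).
Proof. by []. Qed.
Lemma ractE f x : ract f x = \sw_(a, b <- comul x) ((f b : k) *: a).
Proof. by []. Qed.

Lemma lact_ract f g x : lact f (ract g x) = ract g (lact f x).
Proof.
rewrite ractE (lactE f x) !linear_sweedler.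
transitivity (\sw_(a, b <- comul x) \sw_(a1, a2 <- comul a)
    ((f a1 : k) *: ((g b : k) *: a2))).
  apply: eq_sweedler => a b; rewrite linearZZ lactE sweedler_scaler.
  by apply: eq_sweedler => a1 a2; rewrite !scalerA mulrC.
rewrite coassoc3; last by split=> [?|? ?]; [bilin_tac | lin_tac].
by apply: eq_sweedler => a b; rewrite linearZZ ractE sweedler_scaler.
Qed.

Definition stable (A : set C) := forall f x, A x -> A (lact f x) /\ A (ract f x).

Lemma subcoalgebra_stable (D : subcoalgebra C) : stable [set x | x \in D]%classic.
Proof.
move=> f x xD; have [t] := subcoalgP (Sub x xD : subsp D).
rewrite subsp_inclE SubK lactE ractE => ->.
rewrite !sweedler_map; [|exact: ract_bilin|exact: lact_bilin].
by split; apply: rpred_sum => p _; apply: rpredZ; apply: valP.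
Qed.

(** It is enough that retracting either leg of [comul y] to [D] changes nothing. This is tested by
    functionals on the other leg, where it says that [lact f y] and [ract f y] lie in [D]. *)
Lemma stable_subcoalgebra (D : submodClosed C) :
  stable [set x | x \in D]%classic -> is_subcoalgebra D.
Proof.
move=> sD x; set i := subsp_incl D; set y := i x; pose r := subsp_retract D.
have yD : y \in D by apply: valP.
have fixD z : z \in D -> i (r z) = z.
  by move=> zD; rewrite -[z](SubK (subsp D) zD) -!subsp_inclE subsp_retractK.
have Pl : tens_map idfun (i \o r) (comul y) = comul y.
  apply/eqP; rewrite -subr_eq0; apply/eqP/tensor_separation => f.
  pose F := tens_lift (lact_bilin f); rewrite -[LHS]/(F _) linearB.
  apply/eqP; rewrite subr_eq0; apply/eqP.
  rewrite -[RHS]/(lact f y) -(fixD _ (sD f y yD).1).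
  rewrite [LHS]sweedler_map; last exact: lact_bilin.
  rewrite lactE (linear_sweedler (subsp_retract D)) (linear_sweedler i).
  by apply: eq_sweedler => a b; rewrite !linearZZ.
have Pr : tens_map (i \o r) idfun (comul y) = comul y.
  apply/eqP; rewrite -subr_eq0; apply/eqP/tensor_separation_r => f.
  pose F := tens_lift (ract_bilin f); rewrite -[LHS]/(F _) linearB.
  apply/eqP; rewrite subr_eq0; apply/eqP.
  rewrite -[RHS]/(ract f y) -(fixD _ (sD f y yD).2).
  rewrite [LHS]sweedler_map; last exact: ract_bilin.
  rewrite ractE (linear_sweedler (subsp_retract D)) (linear_sweedler i).
  by apply: eq_sweedler => a b; rewrite !linearZZ.
exists (tens_map r r (comul y)); rewrite -{1}Pl -{1}Pr.
move: (comul y); elim/tens_ind => [|v w t IH]; first by rewrite !linear0.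
by rewrite !linearD IH !tens_map_pure.
Qed.

End DualActions.

(** * Averaging projections with a coseparability form *)

Section Coseparable.
Variables (k : fieldType) (C : coalgebra k) (b : C -> C -> k^o).
Hypothesis bb : bilin b.
Hypothesis b_cross : forall x y,
  \sw_(a, c <- comul x) ((b c y : k) *: a) = \sw_(a, c <- comul y) ((b x a : k) *: c).
Hypothesis b_norm : forall x, \sw_(a, c <- comul x) b a c = counit x.

(* Averaging a linear projection onto [D] on the right and on the left gives
   [ract e] and [lact e'].  Both are projections onto [D] and they commute, hence
   they coincide. *)
Lemma subcoalgebra_projection (D : subcoalgebra C) :
  exists Q : {linear C -> C}, [/\ forall x, Q x \in D,
    forall x, x \in D -> Q x = x, forall f x, Q (lact f x) = lact f (Q x),
    forall f x, Q (ract f x) = ract f (Q x)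
    & forall A x, stable A -> A x -> A (Q x)].
Proof.
pose i := subsp_incl D; pose P : {linear C -> C} := i \o subsp_retract D.
have PD x : P x \in D by apply: valP.
have fixD x : x \in D -> P x = x.
  by move=> xD; rewrite /P -[x](SubK (subsp D) xD) -subsp_inclE lin_compE subsp_retractK.
have be : bilin (fun a c => b a (P c)).
  split=> [c|a]; first exact: bb.1.
  by move=> u x y; rewrite linearP bb.2.
have be' : bilin (fun a c => b (P a) c).
  split=> [c|a]; last exact: bb.2.
  by move=> u x y; rewrite linearP bb.1.
pose e : {linear C -> k^o} := tens_lift be \o comul.
pose e' : {linear C -> k^o} := tens_lift be' \o comul.
have eD x : x \in D -> e x = counit x /\ e' x = counit x.
  move=> xD; have [t] := subcoalgP (Sub x xD : subsp D).
  rewrite subsp_inclE SubK => xt; rewrite -b_norm.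
  rewrite -[e x]/(sweedler (comul x) _) -[e' x]/(sweedler (comul x) _) xt !sweedler_map //.
  by split; apply: eq_sweedler => v w; rewrite fixD //; apply: valP.
have actD x : x \in D -> ract e x = x /\ lact e' x = x.
  move=> xD; have [t] := subcoalgP (Sub x xD : subsp D).
  rewrite subsp_inclE SubK => xt; split.
    rewrite -[RHS]counitr ractE xt !sweedler_map; try exact: ract_bilin.
    by apply: eq_sweedler => v w; rewrite (eD _ _).1 //; apply: valP.
  rewrite -[RHS]counitl lactE xt !sweedler_map; try exact: lact_bilin.
  by apply: eq_sweedler => v w; rewrite (eD _ _).2 //; apply: valP.
(* The cross identity gives [x1 b(x2, P x3) = b(x1, (P x2)_1) (P x2)_2], an action on [P x2], which
   lies in the stable [D]. *)
have eE x : ract e x \in D.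
  have -> : ract e x = \sw_(a, c <- comul x) lact (mk_lin (bb.2 a)) (P c).
    transitivity (\sw_(a, c <- comul x) \sw_(a1, a2 <- comul a) ((b a2 (P c) : k) *: a1)).
      rewrite coassoc3; last first.
        split=> [c|a1 a2]; first split=> [a|a] u y z; rewrite ?scaleP_r //.
          by rewrite bb.1 scaleP_l.
        by move=> u y z; rewrite linearP bb.2 scaleP_l.
      by apply: eq_sweedler => a c; rewrite sweedler_scalel.
    by apply: eq_sweedler => a c; rewrite b_cross.
  by apply: rpred_sum => p _; apply: (subcoalgebra_stable _ (PD _)).1.
have e'E x : lact e' x \in D.
  have -> : lact e' x = \sw_(a, c <- comul x) ract (mk_lin (bb.1 c)) (P a).
    transitivity (\sw_(a, c <- comul x) \sw_(c1, c2 <- comul c) ((b (P a) c1 : k) *: c2)).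
      rewrite -(coassoc3 (F := fun a c1 c2 => (b (P a) c1 : k) *: c2)).
        by apply: eq_sweedler => a c; rewrite sweedler_scalel.
      split=> [c|a1 a2]; last by move=> u y z; rewrite scaleP_r.
      by split=> [a|a] u y z; rewrite ?linearP ?bb.1 ?bb.2 scaleP_l.
    by apply: eq_sweedler => a c; rewrite -b_cross.
  by apply: rpred_sum => p _; apply: (subcoalgebra_stable _ (PD _)).2.
have ee' x : ract e x = lact e' x.
  by rewrite -(actD _ (eE x)).2 lact_ract (actD _ (e'E x)).1.
(* As [ract e], the projection commutes with every [lact f] and preserves stable sets; as [lact e'],
   it commutes with every [ract f]. *)
exists (ract e); split=> // [x /actD[]//|f x|f x|A x sA Ax].
- by rewrite lact_ract.
- by rewrite !ee' lact_ract.
- exact: (sA e x Ax).2.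
Qed.

End Coseparable.

(** * Decomposition into simple subcoalgebras *)

Section LocalFiniteness.
Variables (k : fieldType) (C : coalgebra k).
Implicit Types f g : {linear C -> k^o}.

(** By coassociativity both sides are [f(x2) G(x1, x3)]. *)
Lemma ract_lact_cross (U : lmodType k) (G : C -> C -> U) f x : bilin G ->
  \sw_(a, b <- comul x) G (ract f a) b = \sw_(a, b <- comul x) G a (lact f b).
Proof.
move=> bG.
transitivity (\sw_(a, b <- comul x) \sw_(a1, a2 <- comul a) ((f a2 : k) *: G a1 b)).
  apply: eq_sweedler => a b; rewrite ractE -[LHS]/(mk_lin (bG.1 b) _) linear_sweedler.
  by apply: eq_sweedler => a1 a2; rewrite linearZZ.
rewrite coassoc3; last first.
  split=> [c|a1 a2]; last by move=> u y z; rewrite bG.2 scaleP_r.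
  by split=> [a|a] u y z; [rewrite bG.1 scaleP_r | rewrite linearP scaleP_l].
apply: eq_sweedler => a b; rewrite lactE -[RHS]/(mk_lin (bG.2 a) _) linear_sweedler.
by apply: eq_sweedler => b1 b2; rewrite linearZZ.
Qed.

Lemma linear_ract (y : C) : linear (fun f => ract f y).
Proof.
move=> a f g; rewrite !ractE; pose F (u v : C) (h : {linear C -> k^o}) := (h v : k) *: u.
apply: (@sweedler_lin k C C {linear C -> k^o} C (comul y) F) => u v b h h'.
exact: scaleP_l.
Qed.

Lemma ract_ract f g y : ract f (ract g y) = ract (g \o lact f) y.
Proof.
rewrite (ractE g y) (linear_sweedler (ract f)).
transitivity (\sw_(a, b <- comul y) ((g b : k) *: ract f a)).
  by apply: eq_sweedler => a b; rewrite linearZZ.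
exact: (ract_lact_cross _ _ (ract_bilin g)).
Qed.

(* [x1 F(x0, x2)], for varying [F], sweeps out a subcoalgebra containing [x]. *)
Lemma locally_finite (x : C) : exists (A : set C) (s : seq C),
  [/\ is_subspace A, stable A, A x & forall y, A y -> range (seq_comb s) y].
Proof.
pose E (F : {linear C -> {linear C -> k^o}}) : C :=
  \sw_(a, b <- comul x) ract (F a) b.
have bE (F : {linear C -> {linear C -> k^o}}) : bilin (fun a b => ract (F a) b).
  split=> [b|a] u y z; last exact: linearP.
  by rewrite linearP linear_ract.
have lE : linear E.
  move=> u F G; pose T a b (F : {linear C -> {linear C -> k^o}}) := ract (F a) b.
  apply: (@sweedler_lin k C C _ C (comul x) T) => a b v {}F {}G.
  exact: linear_ract.
exists (range E).
(* The middle legs in chosen representatives of the iterated coproduct of [x]: finitely many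
   vectors, which span every [E F]. *)
exists (flatten [seq [seq q.1 | q <- repr (comul p.2)] | p <- repr (comul x)]).
split.
- exact: (range_is_subspace (mk_lin lE)).
(* Each action is absorbed into one argument of [F]: [lact f] into the first by [ract_lact_cross],
   [ract f] into the second by [ract_ract]. *)
- move=> f _ [F _ <-]; split.
    exists (F \o ract f) => //; rewrite /E (linear_sweedler (lact f)).
    rewrite (ract_lact_cross (G := fun a b => ract (F a) b)) //.
    by apply: eq_sweedler => a b; rewrite lact_ract.
  have lF : linear (fun a => F a \o lact f : {linear C -> k^o}).
    by move=> u y z; apply: lin_ext => w /=; rewrite linearP.
  exists (mk_lin lF) => //; rewrite /E (linear_sweedler (ract f)).
  by apply: eq_sweedler => a b; rewrite ract_ract.
(* The choice [F(a, b) = eps(a) eps(b)] recovers [x] by the two counit laws. *)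
- exists (rank1 counit counit) => //; rewrite -[RHS]counitl.
  apply: eq_sweedler => a b; rewrite -[in RHS](counitr b) ractE.
  by rewrite sweedler_scaler; apply: eq_sweedler => b1 b2; rewrite scalerA.
- move=> _ [F _ <-]; apply: subspace_sum; first exact: range_is_subspace.
  move=> p px; apply: subspace_sum; first exact: range_is_subspace.
  move=> q qp; apply: subspaceZ; first exact: range_is_subspace.
  apply: seq_comb_mem; apply/flattenP.
  by exists [seq q.1 | q <- repr (comul p.2)]; apply: map_f.
Qed.

End LocalFiniteness.

Section SimpleDecomposition.
Variables (k : fieldType) (C : coalgebra k) (b : C -> C -> k^o).
Hypothesis bb : bilin b.
Hypothesis b_cross : forall x y,
  \sw_(a, c <- comul x) ((b c y : k) *: a) = \sw_(a, c <- comul y) ((b x a : k) *: c).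
Hypothesis b_norm : forall x, \sw_(a, c <- comul x) b a c = counit x.
Implicit Types A B : set C.

Definition stable_subspace A := is_subspace A /\ stable A.

Definition subcoalgebra_of A (sA : stable_subspace A) : subcoalgebra C.
Proof.
exists (subspace_of sA.1); apply: stable_subcoalgebra => f x /subspace_ofP Ax.
by have [? ?] := sA.2 f x Ax; split; apply/subspace_ofP.
Defined.

Lemma subcoalgebra_ofP A (sA : stable_subspace A) x :
  reflect (A x) (x \in subcoalgebra_of sA).
Proof. exact: subspace_ofP. Qed.

Lemma stable_projection A : stable_subspace A ->
  exists Q : {linear C -> C}, [/\ forall x, A (Q x),
    forall x, A x -> Q x = x, forall f x, Q (lact f x) = lact f (Q x),
    forall f x, Q (ract f x) = ract f (Q x)
    & forall B x, stable B -> B x -> B (Q x)].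
Proof.
move=> sA.
have [Q [QA Q1 Ql Qr QB]] := subcoalgebra_projection bb b_cross b_norm (subcoalgebra_of sA).
exists Q; split=> // x; first exact/(subcoalgebra_ofP sA).
by move=> /(subcoalgebra_ofP sA)/Q1.
Qed.

Lemma stable_subspaceI A B : stable_subspace A -> stable_subspace B ->
  stable_subspace (A `&` B)%classic.
Proof.
move=> [[A0 AP] sA] [[B0 BP] sB]; split; first split=> [//|u x y [? ?] [? ?]].
  by split; [apply: AP | apply: BP].
by move=> f x [Ax Bx]; have [? ?] := sA f x Ax; have [? ?] := sB f x Bx.
Qed.

(** For [Q] the projection onto a stable subspace of [A], this kernel is its stable complement in
    [A]. *)
Lemma stable_kernel A (Q : {linear C -> C}) : stable_subspace A ->
  (forall f x, Q (lact f x) = lact f (Q x)) ->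
  (forall f x, Q (ract f x) = ract f (Q x)) ->
  stable_subspace [set x | A x /\ Q x = 0]%classic.
Proof.
move=> [[A0 AP] sA] Ql Qr; split; first split=> [|u x y [Ax Qx] [Ay Qy]].
- by rewrite /= linear0.
- by split; [apply: AP | rewrite linearP Qx Qy scaler0 addr0].
- by move=> f x [Ax Qx]; have [? ?] := sA f x Ax; split; split=> //;
    rewrite ?Ql ?Qr Qx linear0.
Qed.

Definition simple_stable A := [/\ stable_subspace A, exists2 x, A x & x <> 0
  & forall B, stable_subspace B -> (forall x, B x -> A x) ->
      (forall x, B x -> x = 0) \/ (forall x, A x -> B x)].

Lemma simple_stable_disjoint A B x : simple_stable A -> simple_stable B ->
  A <> B -> A x -> B x -> x = 0.
Proof.
move=> [sA _ mA] [sB _ mB] AB Ax Bx.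
have [y []//|AB0|sAB] := mA (A `&` B)%classic (stable_subspaceI sA sB).
  exact: AB0.
have [y []//|AB0|sBA] := mB (A `&` B)%classic (stable_subspaceI sA sB).
  exact: AB0.
case: AB; apply/seteqP; split=> y; first by move=> /sAB[].
by move=> /sBA[].
Qed.

(** The components, as subsets of [C], index the decomposition; the spanning sequence supplies
    [dec_finite]. *)
Definition component A := simple_stable A /\
  exists s : seq C, forall x, A x -> range (seq_comb s) x.

(* Induction on the dimension of the preimage of [A] under [seq_comb s]. *)
Lemma finite_stable_generated (T : set C) A (s : seq C) : is_subspace T ->
  (forall B, component B -> forall x, B x -> T x) ->
  stable_subspace A -> (forall x, A x -> range (seq_comb s) x) ->
  forall x, A x -> T x.
Proof.
move=> sT compT; pose phi := seq_comb s.
have pre B : is_subspace B -> exists U : {vspace 'rV[k]_(size s)},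
    forall u, B (phi u) <-> u \in U.
  move=> [B0 BP]; apply: (vspace_of_subspace (A := [set u | B (phi u)]%classic)).
  by split=> [|a u v]; rewrite /mkset ?linear0 // linearP; apply: BP.
suff gen n : forall A (U : {vspace 'rV[k]_(size s)}), (\dim U < n)%N ->
    (forall u, A (phi u) <-> u \in U) -> stable_subspace A ->
    (forall x, A x -> range phi x) -> forall x, A x -> T x.
  by move=> sA As; have [U UP] := pre A sA.1; apply: gen (ltnSn _) UP sA As.
elim: n => // n IH {}A U Un UP sA As x Ax.
have step B : stable_subspace B -> (forall y, B y -> A y) ->
    ~ (forall y, A y -> B y) -> forall y, B y -> T y.
  move=> sB BA nAB; have [V VP] := pre B sB.1; apply: (IH _ V) => //.
    move: Un; rewrite ltnS; apply: leq_trans; rewrite ltnNge; apply/negP => UV.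
    apply: nAB => y Ay; have [u _ uy] := As y Ay; rewrite -uy.
    apply/VP; have /eqP -> : V == U.
      by rewrite eqEdim UV andbT; apply/subvP => v /VP/BA/UP.
    by apply/UP; rewrite uy.
  by move=> y /BA/As.
have [sim|nsim] := pselect (simple_stable A).
  by apply: (compT A) => //; split=> //; exists s.
have [[y Ay y0]|nz] := pselect (exists2 y, A y & y <> 0); last first.
  have -> : x = 0 by apply: contrapT => x0; apply: nz; exists x.
  exact: sT.1.
have [B [sB BA [[z Bz z0] nAB]]] : exists B, [/\ stable_subspace B,
    forall y, B y -> A y & (exists2 z, B z & z <> 0) /\ ~ (forall y, A y -> B y)].
  apply: contrapT => nB; apply: nsim; split=> //; first by exists y.
  move=> B sB BA; have [AB|nAB] := pselect (forall y, A y -> B y); first by right.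
  left=> z Bz; apply: contrapT => z0; apply: nB; exists B; split=> //; split=> //.
  by exists z.
(* Split [x] along [B] and the kernel of [Q] on [A]. Both are proper in [A]: [B] by choice, the
   kernel because [Q] fixes [z <> 0]. *)
have [Q [QB Q1 Ql Qr _]] := stable_projection sB.
rewrite -[x](subrK (Q x)); apply: subspaceD => //; last exact: (step B).
apply: (step _ (stable_kernel sA Ql Qr)) => [w []//|/(_ z (BA z Bz))[_]|].
  by rewrite Q1.
split; last by rewrite linearB /= (Q1 (Q x)) // subrr.
by rewrite addrC -scaleN1r; apply: sA.1.2 => //; apply: BA.
Qed.

(** A subcoalgebra of [D] has stable image in [C], since a functional [f] acts on the image as
    [f \o i] acts inside [D]; simplicity of [A] then decides. *)
Lemma simple_stable_coalgebra A (sA : stable_subspace A) : simple_stable A ->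
  simple_coalgebra (subcoalg_coalg (subcoalgebra_of sA)).
Proof.
move=> [_ [x Ax x0] mA]; set D := subcoalgebra_of sA; split.
  have xD : x \in D by apply/subcoalgebra_ofP.
  exists (Sub x xD : subsp D); apply/eqP => /(congr1 (subsp_incl D)).
  by rewrite linear0 subsp_inclE SubK.
move=> E; pose i := subcoalg_incl D.
have i_inj : injective i by apply: val_inj.
pose B := (i @` [set y | y \in E])%classic.
have [||B0|AB] := mA B.
- split; first split=> [|a _ _ [y yE <-] [z zE <-]].
  + by exists 0; rewrite /= ?rpred0 ?linear0.
  + by exists (a *: y + z); rewrite /= ?rpredD ?rpredZ // linearP.
  + move=> f _ [y yE <-]; have [lE rE] := subcoalgebra_stable (f \o i) yE; split.
      exists (lact (f \o i) y) => //; rewrite !lactE subcoalg_inclP linear_sweedler.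
      rewrite sweedler_map; last exact: lact_bilin.
      by apply: eq_sweedler => u v; rewrite linearZZ.
    exists (ract (f \o i) y) => //; rewrite !ractE subcoalg_inclP linear_sweedler.
    rewrite sweedler_map; last exact: ract_bilin.
    by apply: eq_sweedler => u v; rewrite linearZZ.
- by move=> _ [y _ <-]; apply/(subcoalgebra_ofP sA); exact: (valP (y : subsp D)).
- by left=> y yE; apply: i_inj; rewrite linear0; apply: B0; exists y.
- right=> y; have [|z zE /i_inj <- //] := AB (i y).
  by apply/(subcoalgebra_ofP sA); exact: (valP (y : subsp D)).
Qed.

Lemma coseparable_simple_decomposition : inhabited (simple_decomposition C).
Proof.
pose I := {A : set C | `[< component A >]}.
have Icomp (i : I) : component (val i) by case: i => A /= /asboolP.
have sI (i : I) : stable_subspace (val i) by case: (Icomp i) => -[].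
pose D i := subcoalgebra_of (sI i).
have Dfin i : finite_dimensional (subcoalg_coalg (D i)).
  have [_ [s As]] := Icomp i.
  apply: (finite_dimensional_subsp (phi := seq_comb s)) => w /subcoalgebra_ofP/As.
  by case=> u _ <-; exists u.
have Dsim i : simple_coalgebra (subcoalg_coalg (D i)).
  by apply: simple_stable_coalgebra; case: (Icomp i).
pose Phi := dsum_lift (fun i => subcoalg_incl (D i)).
suff bPhi : bijective Phi by constructor; exists I D.
apply: lin_inj_surj_bijective => [x Px|y]; last first.
  have [A [s [sA stA Ay As]]] := locally_finite y.
  suff [x _ <-] : range Phi y by exists x.
  apply: finite_stable_generated As _ Ay => //; first exact: range_is_subspace.
  move=> B Bc z Bz; pose i : I := exist _ B (asboolT Bc).
  have zD : z \in D i by apply/subcoalgebra_ofP.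
  exists (dsum_inj (fun i => subcoalg_coalg (D i)) i (Sub z zD : subsp (D i))) => //.
  by rewrite /Phi dsum_lift_inj.
(* Injectivity: [Q] preserves every component, so it kills those other than [j], which meet
   component [j] in zero. It thus reads off the coordinate [j] of [x]. *)
apply: dsum_ext => j; have [Q [QA Q1 _ _ QB]] := stable_projection (sI j).
pose F := Q \o Phi.
pose G := subcoalg_incl (D j) \o
  mk_lin (dsum_compP (M := fun i => subcoalg_coalg (D i)) j).
have FG : F =1 G.
  apply: lin_dsum_ext => i z.
  have Dz : val i (subcoalg_incl (D i) z).
    by apply/(subcoalgebra_ofP (sI i)); exact: (valP (z : subsp (D i))).
  transitivity (Q (subcoalg_incl (D i) z)); first by rewrite /F /Phi lin_compE dsum_lift_inj.
  have [ij|ij] := eqVneq i j.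
    by subst j; rewrite Q1 // /G lin_compE mk_linE dsum_inj_in.
  rewrite /G lin_compE mk_linE dsum_inj_out // linear0.
  apply: (@simple_stable_disjoint (val i) (val j)).
  - by case: (Icomp i).
  - by case: (Icomp j).
  - by move=> /val_inj/eqP; rewrite (negPf ij).
  - by apply: QB => //; case: (sI i).
  - exact: QA.
have := FG x; rewrite /F lin_compE Px linear0 => /esym Gx.
by apply: (@val_inj _ _ (subsp (D j))); rewrite [LHS]Gx.
Qed.

End SimpleDecomposition.

(** * The coseparability form of an integral *)

Section IntegralForm.
Variables (k : fieldType) (H : hopfAlgebra k).
Notation S := (antipode H).

Lemma hopf_coassoc3 (U : lmodType k) (F : H -> H -> H -> U) (h : H) : trilin F ->
  \sw_(a, b <- hcomul h) \sw_(a1, a2 <- hcomul a) F a1 a2 b =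
  \sw_(a, b <- hcomul h) \sw_(b1, b2 <- hcomul b) F a b1 b2.
Proof. exact: (@coassoc3 k (hopf_coalg H)). Qed.

Lemma hopf_counitl (h : H) : \sw_(a, b <- hcomul h) ((hcounit a : k) *: b) = h.
Proof. exact: (@counitl k (hopf_coalg H)). Qed.
Lemma hopf_counitr (h : H) : \sw_(a, b <- hcomul h) ((hcounit b : k) *: a) = h.
Proof. exact: (@counitr k (hopf_coalg H)). Qed.
Lemma hopf_antipodel (h : H) :
  \sw_(a, b <- hcomul h) (S a * b) = (hcounit h : k) *: 1.
Proof. exact: antipodel. Qed.
Lemma hopf_antipoder (h : H) :
  \sw_(a, b <- hcomul h) (a * S b) = (hcounit h : k) *: 1.
Proof. exact: antipoder. Qed.

Lemma mul_bilin : bilin (fun a c : H => a * c).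
Proof.
by split=> [c|a] u x y; [rewrite mulrDl -scalerAl | rewrite mulrDr -scalerAr].
Qed.

(** Left multiplication by [c \ox d] in the tensor product algebra. *)
Definition lmul2 (c d : H) (t : H \Ox H) : H \Ox H :=
  \sw_(u, v <- t) ((c * u) \ox (d * v)).

Lemma lmul2_bilinr c d : bilin (fun u v : H => (c * u) \ox (d * v)).
Proof. by split=> [v|u] a x y; rewrite mul_bilin.2 ?pureP_l ?pureP_r. Qed.

Lemma lmul2_linear c d : linear (lmul2 c d).
Proof. exact: sweedler_linear (lmul2_bilinr c d). Qed.

Lemma lmul2_bilin t : bilin (fun c d => lmul2 c d t).
Proof.
split=> [d|c].
  apply: (sweedler_lin t (f := fun u v c => (c * u) \ox (d * v))) => u v a x y.
  by rewrite mul_bilin.1 pureP_l.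
apply: (sweedler_lin t (f := fun u v d => (c * u) \ox (d * v))) => u v a x y.
by rewrite mul_bilin.1 pureP_r.
Qed.

Lemma lmul2_lmul2 c d c' d' t : lmul2 c d (lmul2 c' d' t) = lmul2 (c * c') (d * d') t.
Proof.
rewrite /lmul2 sweedler_sweedler; last exact: lmul2_bilinr.
apply: eq_sweedler => u v; rewrite sweedler_pure ?mulrA //; exact: lmul2_bilinr.
Qed.

(* Half of the anti-comultiplicativity of the antipode, obtained by multiplying
   [Delta (x1 S(x2)) = eps(x)] on the left by [S(x0) (x) 1]. *)
Lemma lmul2_antipode x :
  \sw_(a, b <- hcomul x) lmul2 1 a (hcomul (S b)) = S x \ox 1.
Proof.
have AE y : \sw_(a, b <- hcomul y) \sw_(c, d <- hcomul a) lmul2 c d (hcomul (S b)) =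
    (hcounit y : k) *: (1 \ox 1).
  rewrite -hcomul1 -linearZZ -hopf_antipoder linear_sweedler.
  by apply: eq_sweedler => a b; rewrite hcomulM.
have tG t : trilin (fun z c d => lmul2 (S z * c) d t).
  split=> [d|z c]; last exact: (lmul2_bilin t).2.
  split=> [c|z] u p q; rewrite ?linearP ?mul_bilin.1 ?mul_bilin.2 (lmul2_bilin t).1 //.
(* The intermediate expression is [(S(x1) x2 \ox x3) Delta(S(x4))]. Contracting [S(x1) x2] gives the
   left side; contracting [(x2 \ox x3) Delta(S(x4))] by [AE] gives the right side. *)
transitivity (\sw_(z, y <- hcomul x) \sw_(a, b <- hcomul y) \sw_(c, d <- hcomul a)
    lmul2 (S z * c) d (hcomul (S b))).
  rewrite -(hopf_coassoc3 (F := fun z a b =>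
    \sw_(c, d <- hcomul a) lmul2 (S z * c) d (hcomul (S b)))); last first.
    split=> [b|z a]; last first.
      apply: (sweedler_lin _ (f := fun c d b => lmul2 (S z * c) d (hcomul (S b)))).
      by move=> c d u p q; rewrite !linearP lmul2_linear.
    have bG := trilin_lift_bilin (tG (hcomul (S b))).
    by split=> [a|z]; [exact: bG.1 | move=> u p q; rewrite linearP bG.2].
  apply: eq_sweedler => w b; rewrite -hopf_coassoc3; last exact: tG.
  rewrite -{1}[w]hopf_counitl.
  have L := (lmul2_bilin (hcomul (S b))).2 1.
  rewrite -[LHS]/(mk_lin L _) linear_sweedler; apply: eq_sweedler => v d.
  rewrite linearZZ mk_linE.
  pose L' := mk_lin ((lmul2_bilin (hcomul (S b))).1 d).
  rewrite -[lmul2 1 _ _]/(L' 1) -linearZZ -hopf_antipodel linear_sweedler.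
  by [].
transitivity (\sw_(z, y <- hcomul x) ((hcounit y : k) *: (S z \ox (1 : H)))).
  apply: eq_sweedler => z y; pose L := mk_lin (lmul2_linear (S z) 1).
  have -> : S z \ox (1 : H) = L (1 \ox 1).
    by rewrite mk_linE /lmul2 sweedler_pure ?mulr1 //; exact: lmul2_bilinr.
  rewrite -linearZZ -AE linear_sweedler; apply: eq_sweedler => a b.
  rewrite linear_sweedler; apply: eq_sweedler => c d.
  by rewrite mk_linE lmul2_lmul2 mul1r.
rewrite -{2}[x]hopf_counitr linear_sweedler -[RHS]/(purer _ _ _) linear_sweedler.
by apply: eq_sweedler => z y; rewrite !linearZZ.
Qed.

Variable chi : {linear H -> k^o}.
Hypothesis chi_integral : right_integral chi.

(** By the integral property [chi(S(x2) y) x1 = chi(S(x2)_1 y1) x1 S(x2)_2 y2]. The dependence on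
    [x] is through [(1 \ox x1) Delta(S(x2))], which [lmul2_antipode] replaces by [S(x) \ox 1]. *)
Lemma integral_cross x y :
  \sw_(a, c <- hcomul x) ((chi (S c * y) : k) *: a) =
  \sw_(a, c <- hcomul y) ((chi (S x * a) : k) *: c).
Proof.
have intE h : (chi h : k) *: 1 = \sw_(a, b <- hcomul h) ((chi a : k) *: b).
  by rewrite [RHS]chi_integral.
have bchi : bilin (fun p q : H => (chi p : k) *: q) by bilin_tac.
pose K0 u v : H := \sw_(c, d <- hcomul y) ((chi (u * c) : k) *: (v * d)).
have bK : bilin K0.
  split=> [v|u].
    apply: (sweedler_lin _ (f := fun c d u => (chi (u * c) : k) *: (v * d))).
    by move=> c d a p q; rewrite mul_bilin.1 linearP scaleP_l.
  apply: (sweedler_lin _ (f := fun c d v => (chi (u * c) : k) *: (v * d))).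
  by move=> c d a p q; rewrite mul_bilin.1 scaleP_r.
pose K := tens_lift bK.
transitivity (K (S x \ox (1 : H))); last first.
  by rewrite /K tens_lift_pure; apply: eq_sweedler => c d; rewrite mul1r.
rewrite -lmul2_antipode linear_sweedler; apply: eq_sweedler => a c.
have -> : (chi (S c * y) : k) *: a = a * ((chi (S c * y) : k) *: 1).
  by rewrite -scalerAr mulr1.
rewrite intE hcomulM -[LHS]/(mk_lin (mul_bilin.2 a) _).
rewrite [sweedler (sweedler _ _) _]sweedler_sweedler // linear_sweedler.
rewrite /lmul2 (linear_sweedler K); apply: eq_sweedler => u v.
rewrite sweedler_sweedler // linear_sweedler /K tens_lift_pure.
apply: eq_sweedler => p q; rewrite sweedler_pure // linearZZ mk_linE.
by rewrite mul1r mulrA.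
Qed.

Lemma integral_simple_decomposition : chi 1 != 0 ->
  inhabited (simple_decomposition (hopf_coalg H)).
Proof.
(* As [chi(S(x1) x2) = eps(x) chi(1)], the factor [(chi 1)^-1] is what [b_norm] requires. *)
move=> chi1; pose b (x y : hopf_coalg H) : k^o := ((chi 1)^-1 : k) *: chi (S x * y : H).
apply: (@coseparable_simple_decomposition _ _ b).
- by split=> [c|a] u x y; rewrite /b ?linearP ?mul_bilin.1 ?mul_bilin.2 linearP scaleP_r.
- move=> x y; have := congr1 ( *:%R ((chi 1)^-1 : k)) (integral_cross x y).
  rewrite !sweedler_scaler.
  under eq_sweedler => a c do rewrite scalerA.
  under [RHS]eq_sweedler => a c do rewrite scalerA.
  by [].
- move=> x; rewrite -(sweedler_scaler _ _ (fun a c => chi (S a * c))).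
  rewrite -linear_sweedler [sweedler _ _]hopf_antipodel linearZZ.
  rewrite scalerA mulrC -scalerA; rewrite -[_ *: chi 1]/(_ * _) mulVf //.
  exact: mulr1.
Qed.

End IntegralForm.

(** * Comodules over a direct sum of coalgebras *)

Section TensMap.
Variable k : fieldType.

Lemma tens_map_comp (V W V' W' V'' W'' : lmodType k)
    (f : {linear V -> V'}) (g : {linear W -> W'})
    (f' : {linear V' -> V''}) (g' : {linear W' -> W''}) t :
  tens_map f' g' (tens_map f g t) = tens_map (f' \o f) (g' \o g) t.
Proof.
elim/tens_ind: t => [|v w t IH]; first by rewrite !linear0.
by rewrite !linearD IH !tens_map_pure.
Qed.

Lemma eq_tens_map (V W V' W' : lmodType k) (f f' : {linear V -> V'})
    (g g' : {linear W -> W'}) : f =1 f' -> g =1 g' -> tens_map f g =1 tens_map f' g'.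
Proof. by move=> ff' gg' t; rewrite (lin_ext ff') (lin_ext gg'). Qed.

End TensMap.

Section DualActionTheory.
Variables (k : fieldType) (H : coalgebra k).
Implicit Types (M N : comodule H) (f g : {linear H -> k^o}).

Lemma comod_isomorphism M N (f : comod_hom M N) :
  bijective f -> isomorphism (f : arrow (c := comod_cat H) M N).
Proof.
move=> /lin_bijective_inv[g [fK gK]].
have gP n : coact (g n) = \sw_(a, c <- coact n) (g a \ox c).
  rewrite -{2}[n]gK comod_funP sweedler_sweedler; last by bilin_tac.
  rewrite -[LHS]sweedler_id; apply: eq_sweedler => a c.
  by rewrite sweedler_pure ?fK //; bilin_tac.
by exists (ComodHom gP : arrow (c := comod_cat H) N M); split; apply: comod_hom_ext.
Qed.

Lemma coact_counit M (m : M) : \sw_(a, c <- coact m) ((counit c : k) *: a) = m.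
Proof. exact: coact1. Qed.

Lemma dual_actE M (m : M) f :
  dual_act m f = \sw_(a, c <- coact m) ((f c : k) *: a).
Proof. by []. Qed.

Lemma coassoc3_coact M (U : lmodType k) (F : M -> H -> H -> U) m : trilin F ->
  \sw_(a, c <- coact m) \sw_(a0, a1 <- coact a) F a0 a1 c =
  \sw_(a, c <- coact m) \sw_(c1, c2 <- comul c) F a c1 c2.
Proof.
move=> tF; pose G := tens_lift (trilin_lift_bilin tF).
have GE a b c : G (a \ox (b \ox c)) = F a b c.
  rewrite /G tens_lift_pure sweedler_pure //; exact: trilin_bilinr.
have := congr1 G (coactA m); rewrite !linear_sweedler.
under eq_sweedler => a b do
  (rewrite linear_sweedler; under eq_sweedler => a1 a2 do rewrite GE).
under [RHS]eq_sweedler => a b do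
  (rewrite linear_sweedler; under eq_sweedler => a1 a2 do rewrite GE).
by [].
Qed.

(** Both sides are [f(m2) m0 \ox m1]. *)
Lemma coact_dual_act M (m : M) f :
  coact (dual_act m f) = tens_map idfun (ract f) (coact m).
Proof.
rewrite dual_actE linear_sweedler.
transitivity (\sw_(a, c <- coact m) \sw_(a0, a1 <- coact a) ((f c : k) *: (a0 \ox a1))).
  by apply: eq_sweedler => a c; rewrite linearZZ -sweedler_scaler sweedler_id.
rewrite coassoc3_coact; last by split=> [?|? ?]; [bilin_tac | lin_tac].
apply: eq_sweedler => a c; rewrite ractE -[RHS]/(purel _ _ _) linear_sweedler.
by apply: eq_sweedler => c1 c2; rewrite linearZZ.
Qed.

(** Both sides are [f(m1) m0 \ox m2]. With [coact_dual_act], acting by [f] is colinear as soon as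
    [lact f] and [ract f] agree, as they do for [deps i]. *)
Lemma tens_map_dual_act M (m : M) f :
  tens_map (mk_lin ((dual_act_bilin M).1 f)) idfun (coact m) =
  tens_map idfun (lact f) (coact m).
Proof.
transitivity (\sw_(a, c <- coact m) \sw_(a0, a1 <- coact a) ((f a1 : k) *: (a0 \ox c))).
  apply: eq_sweedler => a c; rewrite mk_linE dual_actE -[LHS]/(purer _ _ _).
  by rewrite linear_sweedler; apply: eq_sweedler => a0 a1; rewrite linearZZ.
rewrite coassoc3_coact; last by split=> [?|? ?]; [bilin_tac | lin_tac].
apply: eq_sweedler => a c; rewrite lactE -[RHS]/(purel _ _ _) linear_sweedler.
by apply: eq_sweedler => c1 c2; rewrite linearZZ.
Qed.

End DualActionTheory.

Section DirectSumCoalgebra.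
Variables (k : fieldType) (H : coalgebra k) (I : choiceType).
Variable C : I -> subcoalgebra H.
Hypothesis dec : bijective (dsum_lift (fun i => subcoalg_incl (C i))).
Notation Cc i := (subcoalg_coalg (C i)).
Notation inc i := (subcoalg_incl (C i)).

Definition dec_inv : {linear H -> dsum (fun i => Cc i)} :=
  projT1 (cid (lin_bijective_inv dec)).

Lemma dec_invK : cancel dec_inv (dsum_lift (fun i => inc i)).
Proof. by rewrite /dec_inv; case: cid => g []. Qed.
Lemma dec_liftK : cancel (dsum_lift (fun i => inc i)) dec_inv.
Proof. by rewrite /dec_inv; case: cid => g []. Qed.

Definition dec_proj i : {linear H -> Cc i} :=
  mk_lin (dsum_compP (M := fun i => Cc i) i) \o dec_inv.

Definition dec_glue (U : lmodType k) (f : forall i, {linear Cc i -> U}) :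
  {linear H -> U} := dsum_lift f \o dec_inv.

Lemma dec_inv_inc i c : dec_inv (inc i c) = dsum_inj (fun i => Cc i) i c.
Proof. by rewrite -[RHS]dec_liftK dsum_lift_inj. Qed.

Lemma dec_proj_in i c : dec_proj i (inc i c) = c.
Proof. by rewrite /dec_proj lin_compE dec_inv_inc mk_linE dsum_inj_in. Qed.

Lemma dec_proj_out i j c : i != j -> dec_proj j (inc i c) = 0.
Proof. by move=> ij; rewrite /dec_proj lin_compE dec_inv_inc mk_linE dsum_inj_out. Qed.

Lemma dec_glue_in (U : lmodType k) (f : forall i, {linear Cc i -> U}) i c :
  dec_glue f (inc i c) = f i c.
Proof. by rewrite /dec_glue lin_compE dec_inv_inc dsum_lift_inj. Qed.

Lemma dec_ext (U : lmodType k) (f g : {linear H -> U}) :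
  (forall i c, f (inc i c) = g (inc i c)) -> f =1 g.
Proof.
move=> fg x; rewrite -[x]dec_invK; move: (dec_inv x).
apply: (lin_dsum_ext (f := f \o dsum_lift _) (g := g \o dsum_lift _)) => i c.
by rewrite !lin_compE dsum_lift_inj.
Qed.

(** Allowing any larger duplicate-free list lets finitely many elements share one list, as
    [comod_proj_sum] requires. *)
Lemma dec_sum (x : H) : exists s : seq I, forall s', uniq s' -> {subset s <= s'} ->
  x = \sum_(i <- s') inc i (dec_proj i x).
Proof.
have [s [us xs]] := dsum_suppP (dec_inv x); exists s => s' us' ss'.
rewrite -{1}[x]dec_invK -[LHS]/(dsum_lift_fun _ _) (dsum_lift_funE _ us') //.
by move=> i is'; apply: xs; apply: contra is'; apply: ss'.
Qed.

Definition deps i : {linear H -> k^o} := counit \o dec_proj i.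

Lemma deps_in i c : deps i (inc i c) = counit c.
Proof. by rewrite /deps lin_compE dec_proj_in. Qed.

Lemma deps_out i j c : i != j -> deps j (inc i c) = 0.
Proof. by move=> ij; rewrite /deps lin_compE dec_proj_out // linear0. Qed.

(** Together with [ract_deps], this is the centrality of the idempotent [deps i]. *)
Lemma lact_deps i : lact (deps i) =1 inc i \o dec_proj i.
Proof.
apply: dec_ext => j c; rewrite lactE subcoalg_inclP sweedler_map; last exact: lact_bilin.
have [ji|ji] := eqVneq j i.
  subst j; rewrite [RHS]lin_compE dec_proj_in -[in RHS](counitl c) linear_sweedler.
  by apply: eq_sweedler => a b; rewrite deps_in linearZZ.
rewrite [RHS]lin_compE dec_proj_out // linear0 /sweedler big1 // => p _.
by rewrite deps_out // scale0r.
Qed.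

Lemma ract_deps i : ract (deps i) =1 inc i \o dec_proj i.
Proof.
apply: dec_ext => j c; rewrite ractE subcoalg_inclP sweedler_map; last exact: ract_bilin.
have [ji|ji] := eqVneq j i.
  subst j; rewrite [RHS]lin_compE dec_proj_in -[in RHS](counitr c) linear_sweedler.
  by apply: eq_sweedler => a b; rewrite deps_in linearZZ.
rewrite [RHS]lin_compE dec_proj_out // linear0 /sweedler big1 // => p _.
by rewrite deps_out // scale0r.
Qed.

Section ComoduleComponents.
Variable M : comodule H.

Definition comod_proj i : {linear M -> M} :=
  mk_lin ((dual_act_bilin M).1 (deps i)).

Lemma coact_proj_r i m :
  coact (comod_proj i m) = tens_map idfun (inc i \o dec_proj i) (coact m).
Proof.
by rewrite mk_linE coact_dual_act; apply: eq_tens_map => // x; rewrite ract_deps.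
Qed.

Lemma coact_proj_l i m :
  coact (comod_proj i m) = tens_map (comod_proj i) idfun (coact m).
Proof.
rewrite coact_proj_r tens_map_dual_act.
by apply: eq_tens_map => // x; rewrite lact_deps.
Qed.

Lemma comod_projE i m : comod_proj i m = \sw_(a, c <- coact m) ((deps i c : k) *: a).
Proof. by []. Qed.

Lemma comod_proj_proj i j m :
  comod_proj j (comod_proj i m) = if i == j then comod_proj i m else 0.
Proof.
rewrite [LHS]comod_projE coact_proj_r sweedler_map; last by bilin_tac.
have [->|ij] := eqVneq i j.
  by apply: eq_sweedler => a c; rewrite lin_compE deps_in.
by rewrite /sweedler big1 // => p _; rewrite lin_compE deps_out // scale0r.
Qed.

Lemma comod_proj_sum m : exists s : seq I, m = \sum_(i <- s) comod_proj i m.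
Proof.
(* The second leg is split into its components, enlarging the list with each pure tensor. For
   [t = coact m] the summands are [coact (comod_proj i m)], and the counit then recovers [m]. *)
have tsum (t : M \Ox H) : exists s : seq I, forall s', uniq s' -> {subset s <= s'} ->
    t = \sum_(i <- s') tens_map idfun (inc i \o dec_proj i) t.
  elim/tens_ind: t => [|v w t [s st]].
    by exists [::] => s' _ _; rewrite big1 // => i _; rewrite linear0.
  have [r rw] := dec_sum w; exists (r ++ s) => s' us' ss'.
  under eq_bigr => i _ do rewrite linearD tens_map_pure.
  rewrite big_split /= -st //; last by move=> i si; apply: ss'; rewrite mem_cat si orbT.
  congr (_ + _); rewrite {1}(rw s') //; last first.
    by move=> i ri; apply: ss'; rewrite mem_cat ri.
  by rewrite -[LHS]/(purel _ _ _) linear_sum.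
have [s ms] := tsum (coact m); exists (undup s).
rewrite -{1}[m]coact_counit (ms (undup s)) ?undup_uniq //; last first.
  by move=> i; rewrite mem_undup.
rewrite sweedler_sum; last by bilin_tac.
apply: eq_bigr => i _; rewrite -coact_proj_r coact_counit.
by [].
Qed.

Fact comod_comp_subspace i : is_subspace [set m | comod_proj i m = m]%classic.
Proof.
by split=> [|a x y xP yP]; [rewrite /mkset linear0 | apply: fixed_linear].
Qed.

Definition comod_comp_space i : submodClosed M := subspace_of (comod_comp_subspace i).
Notation V i := (subsp (comod_comp_space i)).
Notation incV i := (subsp_incl (comod_comp_space i)).

Definition comod_comp_proj i : {linear M -> V i} :=
  subsp_retract (comod_comp_space i) \o comod_proj i.

Lemma comod_comp_incl i m : incV i (comod_comp_proj i m) = comod_proj i m.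
Proof.
have mV : comod_proj i m \in comod_comp_space i.
  by apply/subspace_ofP; rewrite /mkset comod_proj_proj eqxx.
by rewrite /comod_comp_proj lin_compE -[comod_proj i m](SubK (V i) mV)
  -!subsp_inclE subsp_retractK.
Qed.

Lemma comod_proj_incl i x : comod_proj i (incV i x) = incV i x.
Proof. by have /subspace_ofP := valP x. Qed.

Lemma comod_comp_projK i : cancel (incV i) (comod_comp_proj i).
Proof. by move=> x; apply: val_inj; rewrite [LHS]comod_comp_incl comod_proj_incl. Qed.

Definition comod_comp_coact i : {linear V i -> V i \Ox Cc i} :=
  tens_map (comod_comp_proj i) (dec_proj i) \o (coact \o incV i).

(** The projection [comod_proj i] fixes [x] and passes to either leg of its coaction, so the
    projections in [comod_comp_coact] lose nothing. *)
Lemma comod_comp_coactE i x :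
  tens_map (incV i) (inc i) (comod_comp_coact i x) = coact (incV i x).
Proof.
rewrite /comod_comp_coact !lin_compE tens_map_comp.
rewrite (eq_tens_map (f' := idfun \o comod_proj i)
  (g' := (inc i \o dec_proj i) \o idfun)) => [||//]; last first.
  by move=> m; rewrite !lin_compE comod_comp_incl.
by rewrite -tens_map_comp -coact_proj_l comod_proj_incl -coact_proj_r comod_proj_incl.
Qed.

Let incVK i := @comod_comp_projK i.
Let incK i : cancel (inc i) (dec_proj i) := @dec_proj_in i.

Fact comod_comp_coactA i x :
  \sw_(a, c <- comod_comp_coact i x) \sw_(a0, a1 <- comod_comp_coact i a)
    (a0 \ox (a1 \ox c)) =
  \sw_(a, c <- comod_comp_coact i x) \sw_(c1, c2 <- comul c) (a \ox (c1 \ox c2)).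
Proof.
apply: (can_inj (tens_map_inj (@incVK i) (tens_map_inj (@incK i) (@incK i)))).
rewrite !linear_sweedler.
transitivity (\sw_(a, c <- coact (incV i x)) \sw_(a0, a1 <- coact a)
    (a0 \ox (a1 \ox c))).
  rewrite -comod_comp_coactE sweedler_map; last by bilin_tac.
  apply: eq_sweedler => a c; rewrite linear_sweedler -comod_comp_coactE.
  rewrite sweedler_map; last by bilin_tac.
  by apply: eq_sweedler => a0 a1; rewrite !tens_map_pure.
rewrite coactA -comod_comp_coactE sweedler_map; last by bilin_tac.
apply: eq_sweedler => a c; rewrite linear_sweedler subcoalg_inclP.
rewrite sweedler_map; last by bilin_tac.
by apply: eq_sweedler => a0 a1; rewrite !tens_map_pure.
Qed.

Fact comod_comp_coact1 i x :
  \sw_(a, c <- comod_comp_coact i x) (counit c *: a) = x.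
Proof.
apply: (can_inj (@incVK i)); rewrite linear_sweedler.
rewrite -[RHS]coact_counit -comod_comp_coactE sweedler_map; last by bilin_tac.
by apply: eq_sweedler => a c; rewrite linearZ.
Qed.

Definition comod_comp i : comodule (Cc i) :=
  Comodule (@comod_comp_coactA i) (@comod_comp_coact1 i).

Definition comod_sum : {linear dsum (fun i => comod_comp i) -> M} :=
  dsum_lift (M := fun i => comod_comp i) (fun i => incV i).

Lemma comod_sum_inj i x : comod_sum (dsum_inj (fun i => comod_comp i) i x) = incV i x.
Proof. by rewrite /comod_sum dsum_lift_inj. Qed.

Fact comod_sumP x : coact (comod_sum x) =
  \sw_(a, c <- dsum_coact comod_comp x) (comod_sum a \ox c).
Proof.
pose F := coact \o comod_sum.
pose G := tens_map comod_sum idfun \o dsum_coact comod_comp.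
apply: (@lin_dsum_ext _ _ _ _ F G) => i {}x; rewrite /F /G !lin_compE comod_sum_inj.
rewrite -comod_comp_coactE dsum_coact_inj [RHS]tens_map_comp.
by apply: eq_tens_map => // y; rewrite lin_compE comod_sum_inj.
Qed.

Lemma comod_sum_bijective : bijective comod_sum.
Proof.
apply: lin_inj_surj_bijective => [x x0|m].
  apply: dsum_ext => j; pose F := comod_comp_proj j \o comod_sum.
  pose G := mk_lin (dsum_compP (M := fun i => comod_comp i) j).
  rewrite -[LHS]/(G x); suff <- : F x = G x by rewrite /F lin_compE x0 linear0.
  apply: lin_dsum_ext => i {x0}x; rewrite /F /G lin_compE comod_sum_inj [RHS]mk_linE.
  apply: (can_inj (@incVK j)); rewrite comod_comp_incl -comod_proj_incl comod_proj_proj.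
  have [ij|ij] := eqVneq i j; last by rewrite dsum_inj_out // linear0.
  by subst j; rewrite dsum_inj_in comod_proj_incl.
have [s ms] := comod_proj_sum m.
exists (\sum_(i <- s) dsum_inj (fun i => comod_comp i) i (comod_comp_proj i m)).
rewrite [RHS]ms linear_sum; apply: eq_bigr => i _.
by rewrite comod_sum_inj comod_comp_incl.
Qed.

End ComoduleComponents.

Lemma dsum_functor_surj (M : comodule H) :
  isomorphic (dsum_functor C (comod_comp M)) (M : comod_cat H).
Proof.
pose f : comod_hom (dsum_comodule (comod_comp M)) M := 
  @ComodHom _ _ (dsum_comodule (comod_comp M)) M (comod_sum M) (@comod_sumP M).
exists f; apply: comod_isomorphism; exact: comod_sum_bijective.
Qed.

(** The projection to a summand is an action of the dual, so every comodule map commutes with it.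
    This is why [dsum_functor] is full. *)
Lemma dual_act_dsum (M : forall i, comodule (Cc i)) i (x : dsum (fun i => M i)) :
  dual_act (x : dsum_comodule M) (deps i) =
  dsum_inj (fun i => M i) i (dsum_comp x i).
Proof.
pose F := mk_lin ((dual_act_bilin (dsum_comodule M)).1 (deps i)).
pose G := dsum_inj (fun i => M i) i \o mk_lin (dsum_compP (M := fun i => M i) i).
apply: (@lin_dsum_ext _ _ _ _ F G) => j y.
change (dual_act (dsum_inj (fun i => M i) j y : dsum_comodule M) (deps i) =
  dsum_inj (fun i => M i) i (dsum_comp (dsum_inj (fun i => M i) j y) i)).
rewrite dual_actE.
rewrite [coact _]dsum_coact_inj sweedler_map; last by bilin_tac.
have [ji|ji] := eqVneq j i.
  subst j; rewrite dsum_inj_in -[in RHS](coact_counit y) linear_sweedler.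
  by apply: eq_sweedler => a c; rewrite deps_in linearZZ.
rewrite dsum_inj_out // linear0 /sweedler big1 // => p _.
by rewrite deps_out // scale0r.
Qed.

Lemma comod_hom_dual_act (P Q : comodule H) (f : comod_hom P Q) x chi :
  f (dual_act x chi) = dual_act (f x) chi.
Proof.
rewrite !dual_actE linear_sweedler comod_funP sweedler_sweedler; last by bilin_tac.
by apply: eq_sweedler => a c; rewrite linearZZ sweedler_pure //; bilin_tac.
Qed.

Section DsumFunctor.
Variables (M N : forall i, comodule (Cc i)).
Variable f : comod_hom (dsum_comodule M) (dsum_comodule N).

Definition dsum_restr i : {linear M i -> N i} :=
  mk_lin (dsum_compP (M := fun i => N i) i) \o (comod_fun f \o dsum_inj (fun i => M i) i).

Lemma dsum_restr_inj i x :
  dsum_inj (fun i => N i) i (dsum_restr i x) = f (dsum_inj (fun i => M i) i x).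
Proof.
rewrite -(dual_act_dsum i (f (dsum_inj (fun i => M i) i x))).
by rewrite -comod_hom_dual_act dual_act_dsum dsum_inj_in.
Qed.

Fact dsum_restrP i x :
  coact (dsum_restr i x) = \sw_(a, c <- coact x) (dsum_restr i a \ox c).
Proof.
have injK : cancel (dsum_inj (fun i => N i) i)
    (mk_lin (dsum_compP (M := fun i => N i) i)).
  by move=> y; rewrite mk_linE dsum_inj_in.
apply: (can_inj (tens_map_inj injK (@dec_proj_in i))).
rewrite -dsum_coact_inj dsum_restr_inj [LHS](comod_funP f) [coact _]dsum_coact_inj.
rewrite sweedler_map; last by bilin_tac.
rewrite linear_sweedler; apply: eq_sweedler => a c.
by rewrite tens_map_pure dsum_restr_inj.
Qed.

End DsumFunctor.

Lemma dsum_functor_equivalence : equivalence (dsum_functor C).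
Proof.
apply: equivalence_full_faithful => [M N g|M N f g fg|M]; last first.
- by exists (comod_comp M); apply: dsum_functor_surj.
- apply: functional_extensionality_dep => i; apply: comod_hom_ext => x.
  have /(congr1 (fun y => dsum_comp y i)) :=
    congr1 (fun h : comod_hom (dsum_comodule M) (dsum_comodule N) =>
      h (dsum_inj (fun i => M i) i x)) fg.
  by rewrite !dsum_map_comp dsum_inj_in.
- exists (fun i => ComodHom (@dsum_restrP M N g i)); apply: comod_hom_ext.
  apply: lin_dsum_ext => i x; rewrite -[RHS]dsum_restr_inj.
  exact: dsum_map_inj.
Qed.

End DirectSumCoalgebra.

(** * Contramodules over a direct sum of coalgebras *)

Section RationalModules.
Variables (k : fieldType) (C : coalgebra k) (fdC : finite_dimensional C).
Notation e := (fd_basis fdC).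
Notation e' := (fd_coord fdC).

Lemma fd_dual_coordE (chi : {linear C -> k^o}) : chi = \sum_j (chi (e j) : k) *: e' j.
Proof.
apply: lin_ext => v; rewrite lin_sumE {1}(fd_coordE fdC v) linear_sum.
by apply: eq_bigr => i _; rewrite linearZ; apply: mulrC.
Qed.

Lemma comul_coordE (c : C) : comul c = \sum_l e l \ox lact (e' l) c.
Proof.
rewrite -[LHS]sweedler_id.
under [RHS]eq_bigr => l _ do rewrite lactE -[_ \ox _]/(purel _ _ _) linear_sweedler.
rewrite /sweedler exchange_big /=; apply: eq_bigr => p _.
rewrite -[LHS]/(purer _ p.2 p.1) {1}(fd_coordE fdC p.1) linear_sum.
by apply: eq_bigr => l _; rewrite linearZZ pureZr.
Qed.

Lemma coact_coordE (M : comodule C) (m : M) :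
  coact m = \sum_j dual_act m (e' j) \ox e j.
Proof.
rewrite -[LHS]sweedler_id.
under [RHS]eq_bigr => j _ do rewrite dual_actE -[_ \ox _]/(purer _ _ _) linear_sweedler.
rewrite /sweedler exchange_big /=; apply: eq_bigr => p _.
rewrite -[LHS]/(purel _ p.1 p.2) {1}(fd_coordE fdC p.2) linear_sum.
by apply: eq_bigr => l _; rewrite linearZZ pureZl.
Qed.

Lemma dual_act_comod_hom (M N : comodule C) (f : {linear M -> N}) :
  (forall m chi, f (dual_act m chi) = dual_act (f m) chi) ->
  forall m, coact (f m) = \sw_(a, c <- coact m) (f a \ox c).
Proof.
move=> fP m; rewrite !coact_coordE sweedler_sum; last by bilin_tac.
by apply: eq_bigr => j _; rewrite sweedler_pure ?fP //; bilin_tac.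
Qed.

Variables (V : lmodType k) (act : V -> {linear C -> k^o} -> V).
Hypothesis bact : bilin act.
Hypothesis actM : forall v chi psi, act (act v psi) chi = act v (psi \o lact chi).
Hypothesis act1 : forall v, act v counit = v.

(** The formula of [coact_coordE] read backwards: for finite-dimensional [C], every module over its
    dual comes from a comodule. *)
Definition rat_coact_fun v : V \Ox C := \sum_j act v (e' j) \ox e j.
Fact rat_coact_linear : linear rat_coact_fun.
Proof.
move=> a x y; rewrite /rat_coact_fun scaler_sumr -big_split /=.
by apply: eq_bigr => j _; rewrite bact.1 pureP_l.
Qed.
Definition rat_coact : {linear V -> V \Ox C} := mk_lin rat_coact_linear.

Lemma sweedler_rat_coact (U : lmodType k) (F : V -> C -> U) v : bilin F ->
  sweedler (rat_coact v) F = \sum_j F (act v (e' j)) (e j).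
Proof.
move=> bF; rewrite mk_linE sweedler_sum //.
by apply: eq_bigr => j _; rewrite sweedler_pure.
Qed.

Lemma act_sum v (chi : {linear C -> k^o}) : \sum_j (chi (e j) : k) *: act v (e' j) = act v chi.
Proof.
rewrite {2}(fd_dual_coordE chi) -[RHS]/(mk_lin (bact.2 v) _) linear_sum.
by apply: eq_bigr => j _; rewrite linearZZ.
Qed.

Fact rat_coactA v :
  \sw_(a, c <- rat_coact v) \sw_(a0, a1 <- rat_coact a) (a0 \ox (a1 \ox c)) =
  \sw_(a, c <- rat_coact v) \sw_(c1, c2 <- comul c) (a \ox (c1 \ox c2)).
Proof.
rewrite sweedler_rat_coact; last by bilin_tac.
rewrite sweedler_rat_coact; last by bilin_tac.
transitivity (\sum_m \sum_l act v (e' m \o lact (e' l)) \ox (e l \ox e m)).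
  apply: eq_bigr => m _; rewrite sweedler_rat_coact; last by bilin_tac.
  by apply: eq_bigr => l _; rewrite actM.
(* The scalar is a structure constant: the coefficient of [e l \ox e m] in [comul (e j)]. *)
transitivity (\sum_j \sum_m \sum_l
    (e' m (lact (e' l) (e j)) : k) *: (act v (e' j) \ox (e l \ox e m))).
  rewrite [RHS]exchange_big; apply: eq_bigr => m _.
  rewrite [RHS]exchange_big; apply: eq_bigr => l _.
  rewrite -act_sum -[LHS]/(purer _ _ _) linear_sum.
  by apply: eq_bigr => j _; rewrite linearZZ.
apply: eq_bigr => j _; rewrite -(linear_sweedler (purel _ (act v (e' j)))) sweedler_id.
rewrite comul_coordE exchange_big linear_sum; apply: eq_bigr => l _.
rewrite [in RHS](fd_coordE fdC (lact _ _)).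
pose P : {linear C -> V \Ox (C \Ox C)} := purel _ (act v (e' j)) \o purel _ (e l).
rewrite -[RHS]/(P (\sum_i _)) linear_sum; apply: eq_bigr => m _.
by rewrite linearZZ.
Qed.

Fact rat_coact1 v : \sw_(a, c <- rat_coact v) (counit c *: a) = v.
Proof.
rewrite sweedler_rat_coact; last by bilin_tac.
by rewrite -[RHS]act1 -act_sum.
Qed.

Definition rat_comodule : comodule C := Comodule rat_coactA rat_coact1.

Lemma rat_dual_act (v : rat_comodule) chi : dual_act v chi = act v chi.
Proof.
rewrite dual_actE [coact v]/(rat_coact v) sweedler_rat_coact; last by bilin_tac.
exact: act_sum.
Qed.

End RationalModules.

(** * The action of the dual on a contramodule *)

Section ContramoduleTheory.
Variables (k : fieldType) (H : coalgebra k).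
Implicit Types (N P : contramodule H).

Lemma contra_isomorphism N P (f : contra_hom N P) :
  bijective f -> isomorphism (f : arrow (c := contra_cat H) N P).
Proof.
move=> /lin_bijective_inv[g [fK gK]].
have gP h : g (contra_act h) = contra_act (g \o h).
  apply: (can_inj fK); rewrite gK contra_funP; congr (contra_act _).
  by apply: lin_ext => x; rewrite !lin_compE gK.
by exists (ContraHom gP : arrow (c := contra_cat H) P N); split;
  apply: contra_hom_ext.
Qed.

Lemma uncurry_bilin (V W U : lmodType k) (F : {linear V -> {linear W -> U}}) :
  bilin (fun v w => F v w).
Proof. by split=> [w|v] a x y; rewrite linearP. Qed.

Lemma contra_act_act N (F : {linear H -> {linear H -> N}}) :
  contra_act (contra_act \o F) = contra_act (tens_lift (uncurry_bilin F) \o comul).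
Proof.
rewrite -contra_actA; congr (contra_act _); apply: lin_ext => x.
rewrite !lin_compE; congr (contra_act _); apply: lin_ext => y.
by rewrite curryE tens_lift_pure.
Qed.

Lemma contra_act_rank1 N (chi : {linear H -> k^o}) (f : {linear H -> N}) :
  contra_act (rank1 chi (contra_act f)) = contra_act (f \o lact chi).
Proof.
have -> : rank1 chi (contra_act f) = contra_act \o rank1 chi f.
  by apply: lin_ext => x; rewrite lin_compE !mk_linE linearZZ.
rewrite contra_act_act; congr (contra_act _); apply: lin_ext => x.
rewrite [LHS]lin_compE [RHS]lin_compE lactE linear_sweedler; apply: eq_sweedler => a b.
by rewrite linearZZ.
Qed.

(** The counterpart of [dual_act]; it sees the contraaction on maps of rank one. *)
Definition cact N (n : N) (chi : {linear H -> k^o}) : N := contra_act (rank1 chi n).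

Lemma cact_bilin N : bilin (@cact N).
Proof.
split=> [chi|n] a x y; rewrite /cact -linearP; congr (contra_act _);
  apply: lin_ext => h.
  exact: scaleP_r.
exact: scaleP_l.
Qed.

Lemma cactM N (n : N) chi psi : cact (cact n psi) chi = cact n (psi \o lact chi).
Proof. by rewrite /cact contra_act_rank1; congr (contra_act _); apply: lin_ext. Qed.

Lemma contra_hom_cact N P (f : contra_hom N P) n chi : f (cact n chi) = cact (f n) chi.
Proof.
rewrite /cact contra_funP; congr (contra_act _); apply: lin_ext => x.
by rewrite lin_compE !mk_linE linearZZ.
Qed.

End ContramoduleTheory.

Section DirectSumContramodules.
Variables (k : fieldType) (H : coalgebra k) (I : choiceType).
Variable C : I -> subcoalgebra H.
Hypothesis dec : bijective (dsum_lift (fun i => subcoalg_incl (C i))).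
Hypothesis fdC : forall i, finite_dimensional (subcoalg_coalg (C i)).
Notation Cc i := (subcoalg_coalg (C i)).
Notation inc i := (subcoalg_incl (C i)).
Notation pr i := (dec_proj dec i).
Notation eps i := (deps dec i).

Lemma dec_proj_lact i (chi : {linear Cc i -> k^o}) x :
  pr i (lact (chi \o pr i) x) = lact chi (pr i x).
Proof.
move: x; apply: (dec_ext dec (f := pr i \o lact (chi \o pr i))
  (g := lact chi \o pr i)) => j c; rewrite [LHS]lin_compE [RHS]lin_compE.
rewrite lactE subcoalg_inclP sweedler_map; last exact: lact_bilin.
have [ji|ji] := eqVneq j i; last first.
  rewrite dec_proj_out // linear0 /sweedler big1 ?linear0 // => p _.
  by rewrite [X in X *: _]lin_compE dec_proj_out // linear0 scale0r.
subst j; rewrite dec_proj_in lactE linear_sweedler; apply: eq_sweedler => a b.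
by rewrite linearZZ dec_proj_in [X in X *: _]lin_compE dec_proj_in.
Qed.

Section ContramoduleComponents.
Variable N : contramodule H.

Definition contra_proj i : {linear N -> N} := mk_lin ((cact_bilin N).1 (eps i)).

Lemma contra_projE i n : contra_proj i n = cact n (eps i).
Proof. by []. Qed.

Lemma contra_proj_act i (f : {linear H -> N}) :
  contra_proj i (contra_act f) = contra_act (f \o (inc i \o pr i)).
Proof.
rewrite contra_projE /cact contra_act_rank1; congr (contra_act _).
by apply: lin_ext => x; rewrite [LHS]lin_compE lact_deps.
Qed.

Lemma contra_proj_cact i n (chi : {linear Cc i -> k^o}) :
  contra_proj i (cact n (chi \o pr i)) = cact n (chi \o pr i).
Proof.
rewrite contra_proj_act; congr (contra_act _); apply: lin_ext => x.
change ((chi (pr i (inc i (pr i x))) : k) *: n = (chi (pr i x) : k) *: n).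
by rewrite dec_proj_in.
Qed.

Lemma contra_proj_proj i n : contra_proj i (contra_proj i n) = contra_proj i n.
Proof. exact: (contra_proj_cact n counit). Qed.

Lemma cact_contra_proj i n (chi : {linear Cc i -> k^o}) :
  cact (contra_proj i n) (chi \o pr i) = cact n (chi \o pr i).
Proof.
rewrite contra_projE cactM; congr cact; apply: lin_ext => x.
rewrite [LHS]lin_compE [LHS]lin_compE dec_proj_lact [RHS]lin_compE.
rewrite lactE linear_sweedler -[in RHS](counitr (pr i x)) linear_sweedler.
by apply: eq_sweedler => a b; rewrite !linearZZ; apply: mulrC.
Qed.

Fact contra_comp_subspace i : is_subspace [set n | contra_proj i n = n]%classic.
Proof.
by split=> [|a x y xP yP]; [rewrite /mkset linear0 | apply: fixed_linear].
Qed.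

Definition contra_comp_space i : submodClosed N := subspace_of (contra_comp_subspace i).
Notation V i := (subsp (contra_comp_space i)).
Notation incV i := (subsp_incl (contra_comp_space i)).

Definition contra_comp_proj i : {linear N -> V i} :=
  subsp_retract (contra_comp_space i) \o contra_proj i.

Lemma contra_comp_incl i n : incV i (contra_comp_proj i n) = contra_proj i n.
Proof.
have nV : contra_proj i n \in contra_comp_space i.
  by apply/subspace_ofP; rewrite /mkset contra_proj_proj.
by rewrite /contra_comp_proj lin_compE -[contra_proj i n](SubK (V i) nV)
  -!subsp_inclE subsp_retractK.
Qed.

Lemma contra_proj_incl i x : contra_proj i (incV i x) = incV i x.
Proof. by have /subspace_ofP := valP x. Qed.

Definition contra_comp_act i (x : V i) (chi : {linear Cc i -> k^o}) : V i :=
  contra_comp_proj i (cact (incV i x) (chi \o pr i)).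

Lemma contra_comp_actE i x chi :
  incV i (contra_comp_act x chi) = cact (incV i x) (chi \o pr i).
Proof. by rewrite contra_comp_incl contra_proj_cact. Qed.

Fact contra_comp_act_bilin i : bilin (@contra_comp_act i).
Proof.
split=> [chi|x] a y z; rewrite /contra_comp_act -linearP; congr (contra_comp_proj i _).
  by rewrite linearP (cact_bilin N).1.
by rewrite -(cact_bilin N).2; congr cact; apply: lin_ext.
Qed.

Fact contra_comp_actM i x (chi psi : {linear Cc i -> k^o}) :
  contra_comp_act (contra_comp_act x psi) chi = contra_comp_act x (psi \o lact chi).
Proof.
apply: val_inj; rewrite -!subsp_inclE !contra_comp_actE cactM; congr cact.
by apply: lin_ext => y; rewrite [LHS]lin_compE [LHS]lin_compE dec_proj_lact.
Qed.

Fact contra_comp_act1 i (x : V i) : contra_comp_act x counit = x.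
Proof. by apply: val_inj; rewrite -!subsp_inclE contra_comp_actE [LHS]contra_proj_incl. Qed.

Definition contra_comp i : comodule (Cc i) :=
  rat_comodule (fdC i) (@contra_comp_act_bilin i) (@contra_comp_actM i)
    (@contra_comp_act1 i).

Definition contra_split : {linear N -> dprod (fun i => contra_comp i)} :=
  dprod_pair (M := fun i => contra_comp i) (fun i => contra_comp_proj i).

(** Projecting to component [i] restricts [f] to [C i]. By finite dimension the restriction is a
    finite sum of rank one maps, on which the contraaction is [cact]. *)
Fact contra_splitP (f : {linear H -> N}) :
  contra_split (contra_act f) = prod_contra_act fdC contra_comp (contra_split \o f).
Proof.
apply: dprod_ext => i; rewrite prod_contra_actE fd_contra_actE.
apply: val_inj; rewrite -[LHS]/(incV i (contra_comp_proj i (contra_act f))).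
rewrite contra_comp_incl contra_proj_act.
transitivity (incV i (\sum_j contra_comp_act
    (contra_comp_proj i (f (inc i (fd_basis (fdC i) j)))) (fd_coord (fdC i) j))); last first.
  congr (incV i _); apply: eq_bigr => j _; rewrite [RHS]rat_dual_act.
  by [].
rewrite linear_sum.
under eq_bigr => j _ do rewrite contra_comp_actE contra_comp_incl cact_contra_proj.
rewrite -linear_sum; congr (contra_act _); apply: lin_ext => x.
rewrite lin_sumE -[LHS]/(f (inc i (pr i x))) {1}(fd_coordE (fdC i) (pr i x)) !linear_sum.
by apply: eq_bigr => j _; rewrite !linearZZ.
Qed.

Lemma contra_split_bijective : bijective contra_split.
Proof.
pose G (u : forall i, N) : {linear H -> N} :=
  dec_glue dec (fun i => rank1 (counit : {linear Cc i -> k^o}) (u i)).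
exists (fun u => contra_act (G (fun i => incV i (u i)))) => [n|u].
  have -> : G (fun i => incV i (contra_split n i)) = G (fun i => contra_proj i n).
    by congr G; apply: funext => i; rewrite -contra_comp_incl.
  (* For [h] in [C i], [F h h'] is [eps(h) eps_i(h') n]. Contraassociativity leads to
     [h |-> F h1 h2], which is [eps(h) n] on every [C i], and the counit axiom returns [n]. *)
  pose F : {linear H -> {linear H -> N}} := dec_glue dec
    (fun i => rank1 (counit : {linear Cc i -> k^o}) (rank1 (eps i) n)).
  have -> : G (fun i => contra_proj i n) = contra_act \o F.
    apply: lin_ext; apply: (dec_ext dec) => i c.
    rewrite [RHS]lin_compE /G /F !dec_glue_in.
    by rewrite -[RHS]/(contra_act ((counit c : k) *: rank1 (eps i) n)) linearZZ.
  rewrite contra_act_act -[RHS]contra_act1; congr (contra_act _); apply: lin_ext.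
  apply: (dec_ext dec) => i c; rewrite [LHS]lin_compE subcoalg_inclP.
  rewrite [LHS]sweedler_map; last exact: uncurry_bilin.
  rewrite -[RHS]/((counit c : k) *: n) -[in RHS](counitl c).
  rewrite (linear_sweedler counit) sweedler_scalel; apply: eq_sweedler => a b.
  rewrite /F dec_glue_in -[LHS]/((counit a : k) *: ((eps i (inc i b) : k) *: n)).
  by rewrite deps_in scalerA [in RHS]linearZZ.
(* Projecting to component [i] restricts [G] to [C i], where it involves only the member [u i] of
   the family. *)
apply: dprod_ext => i; apply: val_inj.
rewrite -[LHS]/(incV i (contra_comp_proj i (contra_act _))) contra_comp_incl.
rewrite contra_proj_act -[RHS]/(incV i (u i)) -contra_proj_incl contra_projE.
congr (contra_act _); apply: lin_ext => x; rewrite [LHS]lin_compE [X in G _ X]lin_compE.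
by rewrite /G dec_glue_in.
Qed.

End ContramoduleComponents.

Lemma prod_functor_surj (N : contramodule H) :
  isomorphic (N : contra_cat H) (prod_functor fdC (contra_comp N)).
Proof.
pose f : contra_hom N (prod_contramodule fdC (contra_comp N)) :=
  @ContraHom _ _ N (prod_contramodule fdC (contra_comp N)) (contra_split N)
    (@contra_splitP N).
exists f; apply: contra_isomorphism; exact: contra_split_bijective.
Qed.

Section ProdFunctor.
Implicit Types M N : forall i, comodule (Cc i).

Definition prod_inj M i : {linear M i -> dprod (fun i => M i)} :=
  subsp_incl _ \o dsum_inj (fun i => M i) i.

Lemma prod_inj_in M i x : prod_inj M i x i = x.
Proof. exact: dsum_inj_in. Qed.
Lemma prod_inj_out M i x j : i != j -> prod_inj M i x j = 0.
Proof. exact: dsum_inj_out. Qed.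

Lemma cact_prod M (x : prod_contramodule fdC M) i (chi : {linear Cc i -> k^o}) :
  cact x (chi \o pr i) = prod_inj M i (dual_act (x i) chi).
Proof.
apply: dprod_ext => j; rewrite [LHS]prod_contra_actE.
have [ij|ij] := eqVneq i j.
  subst j; rewrite prod_inj_in -fd_contra_act_rank1; congr (fd_contra_act _ _ _).
  by apply: lin_ext => c; rewrite -[in RHS](dec_proj_in dec c).
rewrite prod_inj_out //; set g := prod_restrict _ _ _; suff -> : g = 0 by rewrite linear0.
apply: lin_ext => c; rewrite -[LHS]/((chi (pr i (inc j c)) : k) *: x j).
by rewrite dec_proj_out 1?eq_sym // linear0 scale0r.
Qed.

Variables (M N : forall i, comodule (Cc i)).
Variable g : contra_hom (prod_contramodule fdC M) (prod_contramodule fdC N).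

Definition prod_restr i : {linear M i -> N i} :=
  dprod_proj (fun i => N i) i \o (contra_fun g \o prod_inj M i).

Lemma dual_act_counit i (m : M i) : dual_act m counit = m.
Proof. exact: coact_counit. Qed.

(** A linear map on an infinite product need not be determined by its values on the factors. A
    contramodule map is, since by [cact_prod] the projection to a factor is an action of the dual,
    with which [g] commutes. *)
Lemma prod_restrE x i : g x i = prod_restr i (x i).
Proof.
rewrite -[RHS]/(g (prod_inj M i (x i)) i) -[x i in RHS]dual_act_counit -cact_prod.
by rewrite contra_hom_cact cact_prod prod_inj_in [RHS]coact_counit.
Qed.

Fact prod_restrP i m :
  coact (prod_restr i m) = \sw_(a, c <- coact m) (prod_restr i a \ox c).
Proof.
move: m; apply: (dual_act_comod_hom (fdC i)) => m chi.
rewrite -[LHS]/(g (prod_inj M i (dual_act m chi)) i).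
rewrite -{1}[m](prod_inj_in (M := M)) -cact_prod contra_hom_cact cact_prod.
exact: prod_inj_in.
Qed.

End ProdFunctor.

Lemma prod_functor_equivalence : equivalence (prod_functor fdC).
Proof.
apply: equivalence_full_faithful => [M N g|M N f g fg|N]; last first.
- by exists (contra_comp N); apply/isomorphic_sym/prod_functor_surj.
- apply: functional_extensionality_dep => i; apply: comod_hom_ext => x.
  have /(congr1 (fun y => y i)) := congr1 (fun h : contra_hom
    (prod_contramodule fdC M) (prod_contramodule fdC N) => h (prod_inj M i x)) fg.
  by rewrite !prod_mapE prod_inj_in.
- exists (fun i => ComodHom (@prod_restrP M N g i)); apply: contra_hom_ext => x.
  apply: dprod_ext => i; rewrite [RHS]prod_restrE.
  exact: prod_mapE.
Qed.

End DirectSumContramodules.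

(** * The comodule-contramodule correspondence *)

Theorem theorem4p5 (k : fieldType) (char0 : [pchar k] =i pred0)
    (H : hopfAlgebra k) (antipode_inv : bijective (antipode H))
    (chi : {linear H -> k^o}) (chi_integral : right_integral chi)
    (chi1 : chi 1 != 0) :
  inhabited (simple_decomposition (hopf_coalg H)) /\
  forall D : simple_decomposition (hopf_coalg H),
    [/\ exists F : functor (comod_cat (hopf_coalg H))
                           (contra_cat (hopf_coalg H)),
          equivalence F /\
          naturally_isomorphic (compF F (dsum_functor (dec_sub D)))
                               (prod_functor (dec_finite D)),
        forall M : comod_cat (hopf_coalg H),
          exists N : forall i, comod_cat (subcoalg_coalg (dec_sub D i)),
            isomorphic M (dsum_functor (dec_sub D) N)
      & forall M : contra_cat (hopf_coalg H),
          exists N : forall i, comod_cat (subcoalg_coalg (dec_sub D i)),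
            isomorphic M (prod_functor (dec_finite D) N)].
Proof.
split; first exact: integral_simple_decomposition chi_integral chi1.
move=> D; have dec := dec_direct D; split.
(* Both functors start from families of [C i]-comodules, so the span gives the equivalence together
   with its compatibility with sums and products. *)
- exact: equivalence_span (dsum_functor_equivalence dec)
    (prod_functor_equivalence dec (dec_finite D)).
- by move=> M; exists (comod_comp dec M); apply/isomorphic_sym/dsum_functor_surj.
- by move=> N; exists (contra_comp dec (dec_finite D) N); apply: prod_functor_surj.
Qed.
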